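(* Let $\mathbf V=(\mathbf v_1,\dots,\mathbf v_n)$ be a configuration of vectors in $\mathbb R^d$. Then the map $\mathfrak T\mapsto \operatorname{Vert}(\mathfrak T)$ is a bijection between the set of fine zonotopal tilings of the zonotope $\mathcal Z_{\mathbf V}$ and the set of $\mathbf V$-separated collections $\mathcal S\subseteq 2^{[n]}$ that are maximal by size. Moreover, every maximal-by-size $\mathbf V$-separated collection has exactly $|\mathrm{Ind}(\mathbf V)|$ elements, where $\mathrm{Ind}(\mathbf V)$ is the set of subsets $I\subseteq[n]$ such that the vectors $\mathbf v_i$, $i\in I$, are linearly independent.
   Context: Two subsets $I,J\subseteq[n]$ are $\mathbf V$-separated if there is a linear function $h:\mathbb R^d\to\mathbb R$ with $h(\mathbf v_i)>0$ for all $i\in I\setminus J$ and $h(\mathbf v_j)<0$ for all $j\in J\setminus I$. A collection $\mathcal S\subseteq 2^{[n]}$ is $\mathbf V$-separated if any two of its members are $\mathbf V$-separated; it is maximal by size if its cardinality is the largest possible among all $\mathbf V$-separated collections. The zonotope is $\mathcal Z_{\mathbf V}=[0,\mathbf v_1]+\dots+[0,\mathbf v_n]$ (Minkowski sum), the image of the cube $\square_n=[0,e_1]+\dots+[0,e_n]\subset\mathbb R^n$ under the linear map $p:\mathbb R^n\to\mathbb R^d$, $p(e_i)=\mathbf v_i$. A fine zonotopal tiling of $\mathcal Z_{\mathbf V}$ is a collection $\mathfrak T$ of faces of $\square_n$, closed under taking faces, such that $p$ restricts to a homeomorphism from $\bigcup_{F\in\mathfrak T}F$ onto $\mathcal Z_{\mathbf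 V}$. Vertices of $\square_n$ are the points $\sum_{i\in I}e_i$, labeled by $I\subseteq[n]$, and $\operatorname{Vert}(\mathfrak T)\subseteq 2^{[n]}$ is the set of labels $I$ of the vertices of $\square_n$ that belong to $\mathfrak T$. *)

(* Defs.v *)
From Stdlib Require Import Reals ClassicalEpsilon.
From mathcomp Require Import all_boot.

Set Implicit Arguments.
Unset Strict Implicit.
Unset Printing Implicit Defensive.

Local Open Scope R_scope.

Definition pt (k : nat) := 'I_k -> R.

Definition ptadd k (x y : pt k) : pt k := fun i => (x i + y i).
Definition ptscale k (a : R) (x : pt k) : pt k := fun i => (a * x i).

Definition is_linear_fun d (h : pt d -> R) : Prop :=
  (forall x y, h (ptadd x y) = (h x + h y)) /\
  (forall a x, h (ptscale a x) = (a * h x)).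

Definition config (n d : nat) := 'I_n -> pt d.

Definition Vseparated n d (V : config n d) (I J : {set 'I_n}) : Prop :=
  exists h : pt d -> R, is_linear_fun h /\
    (forall i, i \in I :\: J -> (h (V i) > 0)) /\
    (forall j, j \in J :\: I -> (h (V j) < 0)).

Definition Vseparated_coll n d (V : config n d) (S : {set {set 'I_n}}) : Prop :=
  forall I J, I \in S -> J \in S -> Vseparated V I J.

Definition max_by_size n d (V : config n d) (S : {set {set 'I_n}}) : Prop :=
  Vseparated_coll V S /\
  forall S' : {set {set 'I_n}}, Vseparated_coll V S' -> (#|S'| <= #|S|)%N.

Definition lin_indep n d (V : config n d) (I : {set 'I_n}) : Prop :=
  forall a : 'I_n -> R,
    (forall k : 'I_d, \big[Rplus/0]_(i in I) (a i * V i k) = 0) ->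
    forall i, i \in I -> a i = 0.

Definition Ind n d (V : config n d) : {set {set 'I_n}} :=
  [set I : {set 'I_n} | (if excluded_middle_informative (lin_indep V I) then true else false) ].

Definition pmap n d (V : config n d) (x : pt n) : pt d :=
  fun k => \big[Rplus/0]_(i < n) (x i * V i k).

Definition zonotope n d (V : config n d) (y : pt d) : Prop :=
  exists x : pt n, (forall i, 0 <= x i <= 1) /\ pmap V x = y.

(* Nonempty faces of the cube [0,1]^n, encoded by sign vectors:
   F i = Some true  : coordinate i fixed to 1,
   F i = Some false : coordinate i fixed to 0,
   F i = None       : coordinate i free in [0,1]. *)
Definition cface n := {ffun 'I_n -> option bool}.

Definition face_pts n (F : cface n) (x : pt n) : Prop :=
  forall i, match F i with
            | Some true => x i = 1
            | Some false => x i = 0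
            | None => (0 <= x i <= 1)
            end.

Definition subface n (G F : cface n) : bool :=
  [forall i, if F i is Some b then G i == Some b else true].

Definition vertex n (I : {set 'I_n}) : cface n := [ffun i => Some (i \in I)].

Definition Vert n (T : {set cface n}) : {set {set 'I_n}} :=
  [set I : {set 'I_n} | vertex I \in T].

(* sup-distance on R^k (induces the Euclidean topology) *)
Definition dist k (x y : pt k) : R :=
  \big[Rmax/0]_(i < k) Rabs (x i - y i).

Definition homeo_onto n d (f : pt n -> pt d) (X : pt n -> Prop) (Y : pt d -> Prop)
  : Prop :=
  (forall x, X x -> Y (f x)) /\
  (forall y, Y y -> exists x, X x /\ f x = y) /\
  (forall x x', X x -> X x' -> f x = f x' -> x = x') /\
  (forall x0, X x0 -> forall eps, (eps > 0) -> exists delta, (delta > 0) /\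
     forall x, X x -> (dist x x0 < delta) -> (dist (f x) (f x0) < eps)) /\
  (forall x0, X x0 -> forall eps, (eps > 0) -> exists delta, (delta > 0) /\
     forall x, X x -> (dist (f x) (f x0) < delta) -> (dist x x0 < eps)).

Definition fine_tiling n d (V : config n d) (T : {set cface n}) : Prop :=
  (forall F G, F \in T -> subface G F -> G \in T) /\
  homeo_onto (pmap V) (fun x => exists2 F, F \in T & face_pts F x) (zonotope V).

(* Main.v *)
(* The bound on separated collections comes from deletion and contraction of an
   element e: a separated collection S splits as |S| = |S'| + |S''|, where S' is
   the family of all I - e for I in S, and S'' consists of the I with both I and
   I + e in S; S' is separated for the deletion, S'' for the contraction, and
   |Ind V| obeys the same recursion.  The regions of a hyperplane arrangement
   with generic offsets attain the bound.

   Separation makes the projection injective (with Lipschitz inverse) on the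
   union of the faces all of whose vertices lie in S; if |S| = |Ind V|, it is
   surjective by induction: the tiling from S'' is a section of the tiling from
   S', and S tells which faces of the latter lie above and below that section.

   Conversely, deletion and contraction of a tiling are tilings, which gives the
   lower bound |Ind V| for its number of vertices and reduces the separation of
   two vertices I, J to the case where V is a circuit whose signs are given by
   I - J and J - I.  The only topology used is a connectedness argument along
   segments, crossing the tiles one by one. *)
From HB Require Import structures.
From Stdlib Require Import Reals Lra Classical ClassicalEpsilon FunctionalExtensionality.
From mathcomp Require Import all_boot zify.
Require Import Defs.

Set Implicit Arguments.
Unset Strict Implicit.
Unset Printing Implicit Defensive.

Local Open Scope R_scope.

(** The inverse of [Vert] is [full_faces], which remembers only the vertices; two tilings with the
    same vertices are compared inside [full_faces] of them, where the projection is injective. The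
    induction keeps [n] and [d] fixed: an index set [E] shrinks, coordinates outside it are frozen
    at 0, and the quotient by [V e] is realised on a hyperplane. The equality case of the bound is
    what drives surjectivity: if S is extremal, so are S' and S''. The obstacle is then that
    vertices of S' lift to S one at a time, by adding [e] or not, whereas a tile can be used only if
    all its vertices lift to the same side. The side is read off from the height along [V e] above
    the section: separation settles it for one vertex, and a crossing argument spreads it to the
    whole tile. For tilings, the corresponding fact is that coordinate [e] grows with slope between
    0 and 1 along the direction [V e]. *)

Fact RplusA : associative Rplus. Proof. by move=> x y z; ring. Qed.
Fact RmultDl : left_distributive Rmult Rplus. Proof. by move=> x y z; ring. Qed.
Fact RmultDr : right_distributive Rmult Rplus. Proof. by move=> x y z; ring. Qed.
HB.instance Definition _ :=
  Monoid.isComLaw.Build R 0 Rplus RplusA Rplus_comm Rplus_0_l.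
HB.instance Definition _ := Monoid.isMulLaw.Build R 0 Rmult Rmult_0_l Rmult_0_r.
HB.instance Definition _ := Monoid.isAddLaw.Build R Rmult Rplus RmultDl RmultDr.

(** * Finite real sums and simultaneous thresholds *)

Lemma rsum_ge0 (I : finType) (f : I -> R) :
  (forall i, 0 <= f i) -> 0 <= \big[Rplus/0]_i f i.
Proof.
by move=> f0; apply: big_ind => [|x y ? ?|i _]; [lra|lra|exact: f0].
Qed.

Lemma rsum_ge_term (I : finType) (f : I -> R) (j : I) :
  (forall i, 0 <= f i) -> f j <= \big[Rplus/0]_i f i.
Proof.
move=> f0; rewrite (bigD1 j) //=.
suff: 0 <= \big[Rplus/0]_(i | i != j) f i by lra.
by apply: big_ind => [|x y ? ?|i _]; [lra|lra|exact: f0].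
Qed.

Lemma rsum_eq0 (I : finType) (f : I -> R) :
  (forall i, 0 <= f i) -> \big[Rplus/0]_i f i = 0 -> forall i, f i = 0.
Proof. by move=> f0 s0 i; have := rsum_ge_term i f0; have := f0 i; lra. Qed.

Lemma rsum_abs (I : finType) (f : I -> R) :
  Rabs (\big[Rplus/0]_i f i) <= \big[Rplus/0]_i Rabs (f i).
Proof.
apply: (big_ind2 (fun a b => Rabs a <= b)) => [|x x' y y' hx hy|i _].
- by rewrite Rabs_R0; lra.
- by have := Rabs_triang x y; lra.
- lra.
Qed.

Lemma finite_bound (I : finType) (Q : I -> R -> Prop) :
  (forall i, exists L, forall M, L <= M -> Q i M) ->
  exists L, forall M, L <= M -> forall i, Q i M.
Proof.
move=> H.
suff [L HL] : exists L, forall M, L <= M -> forall i, i \in enum I -> Q i M.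
  by exists L => M /HL h i; apply: h; rewrite mem_enum.
elim: (enum I) => [|i s [L HL]]; first by exists 0.
have [L' HL'] := H i; exists (Rmax L L') => M hM j.
have [? ?] := (Rmax_l L L', Rmax_r L L').
rewrite inE => /orP[/eqP ->|js]; first by apply: HL'; lra.
by apply: HL js; lra.
Qed.

Lemma finite_nbhd (I : finType) (Q : I -> R -> Prop) :
  (forall i, exists2 del, 0 < del & forall t, Rabs t < del -> Q i t) ->
  exists2 del, 0 < del & forall t, Rabs t < del -> forall i, Q i t.
Proof.
move=> H.
(* Neighbourhoods of 0 become thresholds at infinity through [M = / del]. *)
have [|L HL] := @finite_bound I (fun i M => forall t, Rabs t * M < 1 -> Q i t).
  move=> i; have [del del0 Hd] := H i; exists (/ del) => M hM t ht; apply: Hd.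
  have e1 : Rabs t * / del <= Rabs t * M.
    by apply: Rmult_le_compat_l => //; exact: Rabs_pos.
  have -> : Rabs t = (Rabs t * / del) * del by field; lra.
  by rewrite -[X in _ < X]Rmult_1_l; apply: Rmult_lt_compat_r => //; lra.
have M0 : 0 < Rmax L 1 by have := Rmax_r L 1; lra.
exists (/ Rmax L 1); first exact: Rinv_0_lt_compat.
move=> t ht i; apply: (HL (Rmax L 1)); first exact: Rmax_l.
rewrite -[X in _ < X](Rinv_l (Rmax L 1)); last lra.
exact: Rmult_lt_compat_r.
Qed.

Lemma affine_sign_nbhd (a b : R) : exists2 del, 0 < del &
  forall t, Rabs t < del -> (a > 0 -> a + t * b > 0) /\ (a < 0 -> a + t * b < 0).
Proof.
have [->|a0] := Req_dec a 0; first by exists 1; [lra|move=> t _; split; lra].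
have b0 := Rabs_pos b; have a1 := Rabs_pos_lt _ a0.
(* The [+ 1] keeps the denominator positive when [b = 0]. *)
exists (Rabs a / (Rabs b + 1)) => [|t ht].
  by apply: Rdiv_lt_0_compat => //; lra.
have tb : Rabs (t * b) < Rabs a.
  rewrite Rabs_mult.
  have e1 : Rabs t * (Rabs b + 1) < Rabs a / (Rabs b + 1) * (Rabs b + 1).
    by apply: Rmult_lt_compat_r => //; lra.
  have e2 : Rabs a / (Rabs b + 1) * (Rabs b + 1) = Rabs a by field; lra.
  by have := Rabs_pos t; nra.
by move: tb; split_Rabs; split; lra.
Qed.

Lemma finite_argmin (I : finType) (A : {set I}) (f : I -> R) (i0 : I) :
  i0 \in A -> exists2 i, i \in A & forall j, j \in A -> f i <= f j.
Proof.
move=> i0A.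
suff H (s : seq I) : i0 \in s -> exists2 i, i \in s & forall j, j \in s -> f i <= f j.
  have [|i] := H (enum A); first by rewrite mem_enum.
  rewrite mem_enum => iA Hi; exists i => // j jA.
  by apply: Hi; rewrite mem_enum.
case: s => // x s _; elim: s x => [|y s IH] x.
  by exists x; [exact: mem_head|move=> j; rewrite inE => /eqP ->; lra].
have [i iy Hi] := IH y.
have [le|gt] := Rle_lt_dec (f x) (f i).
  exists x; first exact: mem_head.
  by move=> j; rewrite inE => /orP[/eqP -> |/Hi]; lra.
exists i; first by rewrite inE iy orbT.
by move=> j; rewrite inE => /orP[/eqP -> |/Hi]; lra.
Qed.

Definition comb k (a : R) (x : pt k) (b : R) (y : pt k) : pt k :=
  fun i => a * x i + b * y i.
Definition zpt k : pt k := fun _ => 0.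
Definition bas k (e : 'I_k) : pt k := fun i => if i == e then 1 else 0.
Definition vpt n (I : {set 'I_n}) : pt n := fun i => if i \in I then 1 else 0.

Lemma ptP k (x y : pt k) : (forall i, x i = y i) -> x = y.
Proof. by move=> H; apply: functional_extensionality. Qed.

Lemma eq_at k (x y : pt k) : x = y -> forall i, x i = y i.
Proof. by move=> ->. Qed.

Section Pmap.
Variables (n d : nat) (V : config n d).

Lemma pmap_comb a (x : pt n) b y :
  pmap V (comb a x b y) = comb a (pmap V x) b (pmap V y).
Proof.
apply: ptP => k; rewrite /pmap /comb !big_distrr /= -big_split /=.
by apply: eq_bigr => i _; ring.
Qed.

Lemma pmap_bas e : pmap V (bas e) = V e.
Proof.
apply: ptP => k; rewrite /pmap (bigD1 e) //= big1 /bas ?eqxx; first by ring.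
by move=> i /negbTE ->; ring.
Qed.

Lemma pmap0 : pmap V (@zpt n) = @zpt d.
Proof. by apply: ptP => k; rewrite /pmap big1 // /zpt => i _; ring. Qed.

Lemma lin_rsum (I : Type) (r : seq I) (h : pt d -> R) (c : I -> R) (W : I -> pt d) :
  is_linear_fun h ->
  h (fun k => \big[Rplus/0]_(i <- r) (c i * W i k)) = \big[Rplus/0]_(i <- r) (c i * h (W i)).
Proof.
move=> [hD hZ]; elim: r => [|i r IH].
  rewrite big_nil -[RHS](Rmult_0_l (h (@zpt d))) -hZ; congr h.
  by apply: ptP => k; rewrite big_nil /ptscale; ring.
rewrite big_cons -IH -hZ -hD; congr h.
by apply: ptP => k; rewrite big_cons.
Qed.

Lemma lin_pmap (h : pt d -> R) (x : pt n) :
  is_linear_fun h -> h (pmap V x) = \big[Rplus/0]_(i < n) (x i * h (V i)).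
Proof. exact: lin_rsum. Qed.

End Pmap.

Section LinearFunctionals.
Variable d : nat.
Implicit Types (h g : pt d -> R).

Lemma lin_comb h a x b y :
  is_linear_fun h -> h (comb a x b y) = a * h x + b * h y.
Proof. by case=> hD hZ; rewrite -!hZ -hD. Qed.

Lemma lin_zpt h : is_linear_fun h -> h (@zpt d) = 0.
Proof.
move=> hl; have -> : @zpt d = comb 0 (@zpt d) 0 (@zpt d).
  by apply: ptP => k; rewrite /comb /zpt; ring.
by rewrite lin_comb //; ring.
Qed.

Lemma lin_of_comb h :
  (forall a x b y, h (comb a x b y) = a * h x + b * h y) -> is_linear_fun h.
Proof.
move=> H; split=> [x y|a x].
  have -> : ptadd x y = comb 1 x 1 y by apply: ptP => k; rewrite /ptadd /comb; ring.
  by rewrite H; ring.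
have -> : ptscale a x = comb a x 0 x by apply: ptP => k; rewrite /ptscale /comb; ring.
by rewrite H; ring.
Qed.

Lemma lin_fun_comb a h b g : is_linear_fun h -> is_linear_fun g ->
  is_linear_fun (fun y => a * h y + b * g y).
Proof. by move=> hl gl; apply: lin_of_comb => *; rewrite !lin_comb //; ring. Qed.

Lemma lin_zero : is_linear_fun (fun _ : pt d => 0).
Proof. by apply: lin_of_comb => *; ring. Qed.

Lemma lin_coord k : is_linear_fun (fun y : pt d => y k).
Proof. by apply: lin_of_comb. Qed.

Lemma zpt_or_coord (y : pt d) : y = @zpt d \/ exists k, y k <> 0.
Proof.
have [[k yk]|H] := classic (exists k, y k <> 0); first by right; exists k.
by left; apply: ptP => k; have [//|yk] := Req_dec (y k) 0; case: H; exists k.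
Qed.

End LinearFunctionals.

(** * Faces of the cube and segments in their images *)

Ltac carrier_cases :=
  do 2?[case: Req_dec_T => ?] => // *; exfalso; lra.

Section Faces.
Variables (n d : nat) (V : config n d).
Implicit Types (G F : cface n) (T : {set cface n}).

Definition face_inj G :=
  forall a b, face_pts G a -> face_pts G b -> pmap V a = pmap V b -> a = b.

Definition cover T (x : pt n) := exists2 F, F \in T & face_pts F x.

Definition cover_inj T :=
  forall x z, cover T x -> cover T z -> pmap V x = pmap V z -> x = z.

(** A point of the relative interior, from which the face can be recovered ([carrier_center]). *)
Definition center F : pt n :=
  fun i => match F i with Some true => 1 | Some false => 0 | None => 1 / 2 end.

(** For a point of the cube, the smallest face that contains it. *)
Definition carrier (x : pt n) : cface n :=
  [ffun i => if Req_dec_T (x i) 0 then Some false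
             else if Req_dec_T (x i) 1 then Some true else None].

Lemma cover_face_inj T G : cover_inj T -> G \in T -> face_inj G.
Proof. by move=> inj GT a b ha hb; apply: inj; exists G. Qed.

Lemma face_pts_comb F a b t : face_pts F a -> face_pts F b -> 0 <= t <= 1 ->
  face_pts F (comb (1 - t) a t b).
Proof.
by move=> ha hb ht i; move: (ha i) (hb i); rewrite /comb; case: (F i) => [[]|]; nra.
Qed.

Lemma face_pts_center F : face_pts F (center F).
Proof. by move=> i; rewrite /center; case: (F i) => [[]|]; lra. Qed.

Lemma carrier_center F : carrier (center F) = F.
Proof.
apply/ffunP => i; rewrite ffunE /center.
by case: (F i) => [[]|]; carrier_cases.
Qed.

Lemma face_pts_carrier (x : pt n) : (forall i, 0 <= x i <= 1) -> face_pts (carrier x) x.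
Proof. by move=> hx i; rewrite ffunE; do 2?case: Req_dec_T => // ?. Qed.

Lemma carrier_subface F x : face_pts F x -> subface (carrier x) F.
Proof.
move=> hx; apply/forallP => i; move: (hx i); rewrite ffunE.
by case: (F i) => [[]|] //; carrier_cases.
Qed.

Lemma subface_trans F G H : subface F G -> subface G H -> subface F H.
Proof.
move=> /forallP h1 /forallP h2; apply/forallP => i; move: (h1 i) (h2 i).
by case: (H i) => [b|] //; case: (G i) => [c|] // h /eqP [<-].
Qed.

Lemma face_pts_sub G F x : subface G F -> face_pts G x -> face_pts F x.
Proof.
move=> /forallP h hx i; move: (h i) (hx i).
case: (F i) => [b|]; first by move=> /eqP ->.
by case: (G i) => [[]|] _; lra.
Qed.

Lemma face_pts_cube F x : face_pts F x -> forall i, 0 <= x i <= 1.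
Proof. by move=> hx i; move: (hx i); case: (F i) => [[]|]; lra. Qed.

Lemma face_pts_vpt F (I : {set 'I_n}) : face_pts F (vpt I) <-> subface (vertex I) F.
Proof.
split=> [h|h].
  apply/forallP => i; move: (h i); rewrite /vpt ffunE.
  by case: (F i) => [[]|] //; case: (i \in I) => //; lra.
apply: face_pts_sub h _ => i; rewrite ffunE /vpt.
by case: (i \in I).
Qed.

(* A small multiple of a kernel vector in the direction of a face can be added
   to the centre of the face. *)
Lemma face_free_inj G c : face_inj G -> (forall i, G i -> c i = 0) ->
  pmap V c = @zpt d -> c = @zpt n.
Proof.
move=> inj c0 pc.
have [L HL] : exists L, forall M, L <= M -> forall i, Rabs (c i) <= M.
  by apply: finite_bound => i; exists (Rabs (c i)).
have M1 := Rmax_r L 1; set M := Rmax L 1 in M1.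
have cM i : Rabs (c i) <= M by apply: HL; exact: Rmax_l.
(* With this factor every [e * c i] is at most 1/2 in absolute value, the distance from a free
   coordinate of the centre to 0 and 1. *)
pose e := / (2 * M).
have e0 : 0 < e by apply: Rinv_0_lt_compat; lra.
have eM : e * M = 1 / 2 by rewrite /e; field; lra.
have inG : face_pts G (comb 1 (center G) e c).
  move=> i; move: (c0 i) (cM i); rewrite /comb /center.
  case: (G i) => [[]|] /= h; [by rewrite h //; lra|by rewrite h //; lra|].
  by move=> ci; have hc : - M <= c i <= M by [split_Rabs; lra]; nra.
have /eq_at E : comb 1 (center G) e c = center G.
  apply: inj => //; first exact: face_pts_center.
  by rewrite pmap_comb pc; apply: ptP => k; rewrite /comb /zpt; ring.
apply: ptP => i; move: (E i); rewrite /comb /zpt => Ei.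
have : e * c i = 0 by lra.
by move/Rmult_integral => [|//]; lra.
Qed.

(** The parameters at which the line meets the image of the face form a closed set. No compactness
    is used: once two parameters are met, injectivity puts all preimages on one line [l], and if
    [l s0] is outside the face it violates an inequality strictly, hence so do the nearby points of
    [l]. *)
Lemma face_line_closed G (y w : pt d) s0 : face_inj G ->
  exists2 del, 0 < del & forall t, Rabs t < del -> forall a, face_pts G a ->
    pmap V a = comb 1 y (s0 + t) w ->
    exists2 a0, face_pts G a0 & pmap V a0 = comb 1 y s0 w.
Proof.
move=> inj.
have [H|no0] := classic (exists2 a0, face_pts G a0 & pmap V a0 = comb 1 y s0 w).
  by exists 1; [lra|].
have [[s1 [a1 [G1 p1]]]|no1] :=
    classic (exists s1 a1, face_pts G a1 /\ pmap V a1 = comb 1 y s1 w); last first.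
  by exists 1; [lra|move=> t _ a Ga pa; case: no1; exists (s0 + t), a].
have [[s2 [a2 [G2 [p2 s12]]]]|no2] :=
    classic (exists s2 a2, face_pts G a2 /\ pmap V a2 = comb 1 y s2 w /\ s2 <> s1); last first.
  exists (Rabs (s1 - s0)).
    by apply: Rabs_pos_lt => s10; case: no0; exists a1 => //; have <- : s1 = s0 by lra.
  move=> t ht a Ga pa; case: no2; exists (s0 + t), a; split=> //; split=> // st.
  by move: ht; have -> : s1 - s0 = t by [lra]; lra.
have ds : s2 - s1 <> 0 by lra.
pose u := comb (/ (s2 - s1)) a2 (- / (s2 - s1)) a1.
pose l s := comb 1 a1 (s - s1) u.
have pl s : pmap V (l s) = comb 1 y s w.
  rewrite !pmap_comb p1 p2; apply: ptP => k; rewrite /comb.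
  by field.
have u0 i : G i -> u i = 0.
  move: (G1 i) (G2 i); rewrite /u /comb.
  by case: (G i) => [[]|] //= -> -> _; ring.
have [i [Gi vi]] : exists i, G i = None /\ (l s0 i < 0 \/ 1 - l s0 i < 0).
  apply: NNPP => H; apply: no0; exists (l s0) => // i.
  move: (u0 i) (G1 i) (fun h => H (ex_intro _ i h)); rewrite /l /comb.
  case: (G i) => [[]|] /= u00; [by rewrite u00 // => ->; lra|by rewrite u00 // => ->; lra|].
  by move=> _ h; split; apply: Rnot_lt_le => h'; apply: h; split=> //; lra.
have [d1 d10 D1] := affine_sign_nbhd (l s0 i) (u i).
have [d2 d20 D2] := affine_sign_nbhd (1 - l s0 i) (- u i).
exists (Rmin d1 d2); first exact: Rmin_glb_lt.
move=> t ht a Ga pa.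
have E : comb 1 a (-1) (l (s0 + t)) = @zpt n.
  apply: (face_free_inj inj) => [j Gj|].
    have uj := u0 j Gj; move: (G1 j) (Ga j) Gj; rewrite /l /comb uj.
    by case: (G j) => [[]|] //= -> -> _; lra.
  by rewrite pmap_comb pl pa; apply: ptP => k; rewrite /comb /zpt; ring.
have := eq_at E i; rewrite /l /comb /zpt => Ei.
have [m1 m2] := (Rmin_l d1 d2, Rmin_r d1 d2).
have [|_ D1'] := D1 t; first lra.
have [|_ D2'] := D2 t; first lra.
move: (Ga i) D1' D2' vi; rewrite Gi /l /comb => gai D1' D2'.
by case=> [/D1'|/D2']; nra.
Qed.

(* The segment from [y] to [y + w] is covered by finitely many images of faces,
   each meeting it in a closed set, so a supremum argument propagates [P]. *)
Lemma path_invariant T (y w : pt d) (P : R -> pt n -> Prop) x z :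
  cover_inj T -> cover T x -> pmap V x = y -> cover T z -> pmap V z = comb 1 y 1 w ->
  (forall s, 0 <= s <= 1 -> exists2 a, cover T a & pmap V a = comb 1 y s w) ->
  P 0 x ->
  (forall s s' G a b, 0 <= s -> s <= s' -> s' <= 1 -> G \in T ->
     face_pts G a -> face_pts G b ->
     pmap V a = comb 1 y s w -> pmap V b = comb 1 y s' w -> P s a -> P s' b) ->
  P 1 z.
Proof.
move=> inj Tx px Tz pz surj P0 step.
have loc s0 : exists2 del, 0 < del & forall t, Rabs t < del ->
    forall G, G \in T -> forall a, face_pts G a -> pmap V a = comb 1 y (s0 + t) w ->
    exists2 a0, face_pts G a0 & pmap V a0 = comb 1 y s0 w.
  apply: (@finite_nbhd _ (fun G t => G \in T -> forall a, face_pts G a ->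
    pmap V a = comb 1 y (s0 + t) w ->
    exists2 a0, face_pts G a0 & pmap V a0 = comb 1 y s0 w)) => G.
  have [GT|GT] := boolP (G \in T); last by exists 1; [lra|].
  have [del del0 H] := face_line_closed y w s0 (cover_face_inj inj GT).
  by exists del => // t ht _; exact: H.
pose K s := 0 <= s <= 1 /\ forall a, cover T a -> pmap V a = comb 1 y s w -> P s a.
have K0 : K 0.
  split=> [|a Ta pa]; first lra.
  suff -> : a = x by [].
  by apply: inj; rewrite ?pa ?px //; apply: ptP => k; rewrite /comb; ring.
have [|| m [ub lub]] := completeness K.
- by exists 1 => s [? _]; lra.
- by exists 0.
have m0 : 0 <= m by apply: ub.
have m1 : m <= 1 by apply: lub => s [? _]; lra.
(* Every face met within [del] of [m] is also met at [m]. One application of [step] inside such a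
   face carries [P] from below into [m], and another one carries it from [m] to [m + r],
   contradicting the supremum. *)
have [del del0 D] := loc m.
have Km : K m.
  split=> // a Ta pa.
  have [s [Ks sm]] : exists s, K s /\ m - del < s.
    apply: NNPP => H; have : m <= m - del; last lra.
    by apply: lub => s Ks; apply: Rnot_lt_le => ?; apply: H; exists s.
  have sm' := ub _ Ks; case: Ks => s01 Ps.
  have [b Tb pb] := surj s s01; have [G GT Gb] := Tb.
  have [||| a0 Ga0 pa0] := D (s - m) _ G GT b => //; first by split_Rabs; lra.
    by rewrite pb; congr (comb _ _ _ _); lra.
  have -> : a = a0 by apply: inj => //; [exists G|rewrite pa pa0].
  apply: (step s m G b a0) => //; try lra.
  exact: Ps.
have [mlt|mge] := Rlt_le_dec m 1; last first.
  by have E : m = 1 by [lra]; rewrite E in Km; apply: Km.2.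
have r1 := Rmin_l (del / 2) (1 - m); have r2 := Rmin_r (del / 2) (1 - m).
have r0 : 0 < Rmin (del / 2) (1 - m) by apply: Rmin_glb_lt; lra.
set r := Rmin _ _ in r0 r1 r2.
suff : K (m + r) by move/ub; lra.
split=> [|a Ta pa]; first lra.
have [G GT Ga] := Ta.
have [|b Gb pb] := D r _ G GT a Ga pa; first by rewrite Rabs_pos_eq; lra.
apply: (step m (m + r) G b a) => //; try lra.
by apply: Km.2 => //; exists G.
Qed.

End Faces.

(** * Deletion and contraction *)

Section Contraction.
Variable d : nat.
Implicit Types (u y : pt d).

(* The projection along [u] to the hyperplane [y k = 0] (for [u k <> 0]): it
   stands for the quotient by the line [R u], so that the contraction of a
   configuration lives in the same space. *)
Definition shadow u (k : 'I_d) y : pt d := comb 1 y (- (y k / u k)) u.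

Definition contract n (V : config n d) (e : 'I_n) (k : 'I_d) : config n d :=
  fun i => shadow (V e) k (V i).

Lemma shadow_comb u k a x b y : u k <> 0 ->
  shadow u k (comb a x b y) = comb a (shadow u k x) b (shadow u k y).
Proof. by move=> uk; apply: ptP => j; rewrite /shadow /comb; field. Qed.

Lemma shadow_self u k : u k <> 0 -> shadow u k u = @zpt d.
Proof. by move=> uk; apply: ptP => j; rewrite /shadow /comb /zpt; field. Qed.

Lemma shadow_eq u k y y' : u k <> 0 ->
  shadow u k y = shadow u k y' <-> exists t, y' = comb 1 y t u.
Proof.
move=> uk; split=> [H|[t ->]].
  exists (y' k / u k - y k / u k); apply: ptP => j.
  by move/eq_at/(_ j): H; rewrite /shadow /comb; lra.
by rewrite shadow_comb // shadow_self //; apply: ptP => j; rewrite /comb /zpt; ring.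
Qed.

Lemma lin_shadow h u k : u k <> 0 -> is_linear_fun h ->
  is_linear_fun (fun y => h (shadow u k y)).
Proof.
by move=> uk hl; apply: lin_of_comb => *; rewrite shadow_comb // lin_comb.
Qed.

Lemma pmap_contract n (V : config n d) e k x : V e k <> 0 ->
  pmap (contract V e k) x = shadow (V e) k (pmap V x).
Proof.
move=> Vek; apply: ptP => j.
rewrite /shadow /comb /pmap /contract /shadow /comb.
transitivity (\big[Rplus/0]_(i < n) (1 * (x i * V i j) + (- (V e j / V e k)) * (x i * V i k))).
  by apply: eq_bigr => i _; field.
by rewrite big_split /= -!big_distrr /=; field.
Qed.

(** Reads equality in the contraction as a height [t] along [V e], the quantity that the later
    arguments compare. *)
Lemma pmap_contract_eq n (V : config n d) e k x z : V e k <> 0 ->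
  pmap (contract V e k) x = pmap (contract V e k) z <->
  exists t, pmap V z = comb 1 (pmap V x) t (V e).
Proof. by move=> Vek; rewrite !pmap_contract //; exact: shadow_eq. Qed.

End Contraction.

(** * Families of sets after removal of one element *)

Section SetFamilies.
Variable n : nat.
Implicit Types (E I J : {set 'I_n}) (S : {set {set 'I_n}}) (e : 'I_n).

Lemma set_ind_strong (P : {set 'I_n} -> Prop) :
  (forall E, (forall e, e \in E -> P (E :\ e)) -> P E) -> forall E, P E.
Proof.
move=> PS E; have [m] := ubnP #|E|; elim: m E => // m IH E Em.
by apply: PS => e eE; apply: IH; move: Em; rewrite (cardsD1 e E) eE.
Qed.

Lemma set_ind_D1 (P : {set 'I_n} -> Prop) :
  P set0 -> (forall E e, e \in E -> P (E :\ e) -> P E) -> forall E, P E.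
Proof.
move=> P0 PS; apply: set_ind_strong => E IH.
by have [->//|[e eE]] := set_0Vmem E; apply: PS (eE) (IH e eE).
Qed.

Definition addb (b : bool) e I := if b then e |: I else I.

Lemma in_addb b e I i : (i \in addb b e I) = ((i == e) && b) || (i \in I).
Proof. by case: b; rewrite /addb ?inE ?andbT ?andbF. Qed.

Definition link b e S := [set I : {set 'I_n} | (e \notin I) && (addb b e I \in S)].
Definition del e S := link false e S :|: link true e S.
Definition con e S := link false e S :&: link true e S.

Lemma card_link e S : #|S| = (#|link false e S| + #|link true e S|)%N.
Proof.
rewrite -(cardsID [set I : {set 'I_n} | e \in I] S) addnC; congr addn.
  by apply: eq_card => I; rewrite !inE.
rewrite -(@card_in_imset _ _ (fun I : {set 'I_n} => e |: I) (link true e S)).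
  apply: eq_card => I; rewrite !inE; apply/andP/imsetP => [[IS eI]|[J]].
    by exists (I :\ e); rewrite ?inE ?eqxx /addb /= ?setD1K.
  by rewrite inE => /andP[_ JS] ->; rewrite setU11.
move=> I J; rewrite !inE => /andP[eI _] /andP[eJ _] E.
by rewrite -(setU1K eI) E setU1K.
Qed.

Lemma card_del_con e S : #|S| = (#|del e S| + #|con e S|)%N.
Proof. by rewrite cardsUI -card_link. Qed.

Lemma mem_del e S I : I \in del e S <-> e \notin I /\ exists b, addb b e I \in S.
Proof.
rewrite !inE; split=> [/orP[]/andP[eI IS]|[-> [[] ->]]] //=; last by rewrite orbT.
  by split=> //; exists false.
by split=> //; exists true.
Qed.

Lemma mem_con e S I : I \in con e S <-> e \notin I /\ forall b, addb b e I \in S.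
Proof.
rewrite !inE; split=> [/andP[/andP[eI IS] /andP[_ IS']]|[-> H]].
  by split=> // -[].
by rewrite (H false) (H true).
Qed.

Lemma sub_con_del e S : con e S \subset del e S.
Proof. exact: subset_trans (subsetIl _ _) (subsetUl _ _). Qed.

Lemma del_powerset e S E : S \subset powerset E -> del e S \subset powerset (E :\ e).
Proof.
move=> /subsetP SE; apply/subsetP => I /mem_del [eI [b /SE]].
rewrite !inE => /subsetP bE; apply/subsetP => i iI; rewrite !inE.
rewrite bE ?in_addb ?iI ?orbT // andbT.
by apply: contraNneq eI => <-.
Qed.

Lemma con_powerset e S E : S \subset powerset E -> con e S \subset powerset (E :\ e).
Proof. by move=> /(del_powerset e); exact: subset_trans (sub_con_del e S). Qed.

End SetFamilies.

(** * Independent sets under deletion and contraction *)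

Section Independence.
Variables n d : nat.
Implicit Types (V : config n d) (E I J : {set 'I_n}).

Lemma lin_indepP V I : lin_indep V I <->
  (forall a : pt n, (forall i, i \notin I -> a i = 0) -> pmap V a = @zpt d -> a = @zpt n).
Proof.
split=> [H a a0 pa|H a Ha i iI].
  apply: ptP => i; have [iI|/a0 //] := boolP (i \in I); apply: (H a) => // k.
  have := eq_at pa k; rewrite /pmap /zpt (bigID (mem I)) /=.
  by rewrite [X in _ + X]big1 ?Rplus_0_r // => j /a0 ->; ring.
pose a' : pt n := fun j => if j \in I then a j else 0.
have /eq_at/(_ i) : a' = @zpt n; last by rewrite /a' iI.
apply: H => [j /negbTE jI|]; first by rewrite /a' jI.
apply: ptP => k; transitivity (\big[Rplus/0]_(i in I) (a i * V i k)); last exact: Ha.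
rewrite /pmap [RHS]big_mkcond /=.
by apply: eq_bigr => j _; rewrite /a'; case: ifP => // _; ring.
Qed.

Lemma lin_indep0 V : lin_indep V set0.
Proof. by move=> a _ i; rewrite inE. Qed.

Lemma lin_indep_loop V I e : V e = @zpt d -> e \in I -> ~ lin_indep V I.
Proof.
move=> Ve eI /lin_indepP /(_ (bas e)) H.
have /eq_at/(_ e) : bas e = @zpt n; last by rewrite /bas /zpt eqxx; lra.
apply: H; last by rewrite pmap_bas.
by move=> i iI; rewrite /bas; case: eqP => // ie; rewrite ie eI in iI.
Qed.

Lemma lin_indep_contract V I e k : V e k <> 0 -> e \notin I ->
  lin_indep V (e |: I) <-> lin_indep (contract V e k) I.
Proof.
move=> Vek eI; rewrite !lin_indepP; split=> H a a0 pa.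
  have : pmap (contract V e k) (@zpt n) = pmap (contract V e k) a by rewrite pa pmap0.
  move/pmap_contract_eq => /(_ Vek) [t]; rewrite pmap0 => pt_.
  have E : comb 1 a (- t) (bas e) = @zpt n.
    apply: H => [i|]; last first.
      by rewrite pmap_comb pmap_bas pt_; apply: ptP => j; rewrite /comb /zpt; ring.
    rewrite !inE negb_or /comb /bas => /andP[/negbTE -> /a0 ->]; ring.
  have ae : a e = 0 by apply: a0.
  have := eq_at E e; rewrite /comb /bas eqxx ae /zpt => t0.
  apply: ptP => i; have := eq_at E i; rewrite /comb /zpt.
  by have -> : - t = 0 by [lra]; lra.
pose a' := comb 1 a (- a e) (bas e).
have E : a' = @zpt n.
  apply: H => [i iI|].
    rewrite /a' /comb /bas; case: (altP (i =P e)) => [->|ie]; first ring.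
    by rewrite a0 ?inE ?negb_or ?ie //; ring.
  rewrite -(pmap0 (contract V e k)); apply/pmap_contract_eq => //; exists (a e).
  by rewrite pmap0 pmap_comb pa pmap_bas; apply: ptP => j; rewrite /comb /zpt; ring.
have Ei i : a i = a e * bas e i by have := eq_at E i; rewrite /a' /comb /zpt; lra.
have aE : a = comb (a e) (bas e) 0 (bas e) by apply: ptP => i; rewrite /comb Ei; ring.
have : a e * V e k = 0.
  by have := eq_at pa k; rewrite {1}aE pmap_comb pmap_bas /comb /zpt; lra.
move/Rmult_integral => [ae|//]; apply: ptP => i; rewrite Ei ae /zpt; ring.
Qed.

Definition IndE V E := Ind V :&: powerset E.

Lemma in_Ind V I : (I \in Ind V) <-> lin_indep V I.
Proof. by rewrite inE; case: excluded_middle_informative. Qed.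

Lemma in_IndE V E I : (I \in IndE V E) <-> lin_indep V I /\ I \subset E.
Proof. by rewrite in_setI powersetE; split=> [/andP[/in_Ind]|[/in_Ind -> ->]]. Qed.

Lemma IndE0 V : IndE V set0 = [set set0].
Proof.
apply/setP => I; rewrite in_set1; apply/idP/idP.
  by move/in_IndE => [_]; rewrite subset0.
by move/eqP ->; apply/in_IndE; split; [exact: lin_indep0|exact: sub0set].
Qed.

Lemma link_IndE V E e : link false e (IndE V E) = IndE V (E :\ e).
Proof.
apply/setP => I; rewrite in_set /addb /=; apply/andP/idP.
  by move=> [eI /in_IndE [iI IE]]; apply/in_IndE; rewrite subsetD1 IE.
by move/in_IndE; rewrite subsetD1 => -[iI /andP[IE ->]]; split=> //; apply/in_IndE.
Qed.

Lemma card_IndE_loop V E e : V e = @zpt d -> #|IndE V E| = #|IndE V (E :\ e)|.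
Proof.
move=> Ve; rewrite (card_link e) link_IndE (_ : link true e _ = set0) ?cards0 ?addn0 //.
apply/setP => I; rewrite in_set in_set0; apply/negP => /andP[_ /in_IndE [iI _]].
exact: lin_indep_loop Ve (setU11 _ _) iI.
Qed.

Lemma card_IndE_contract V E e k : e \in E -> V e k <> 0 ->
  #|IndE V E| = (#|IndE V (E :\ e)| + #|IndE (contract V e k) (E :\ e)|)%N.
Proof.
move=> eE Vek; rewrite (card_link e) link_IndE; congr addn.
apply: eq_card => I; rewrite in_set; apply/andP/idP.
  move=> [eI /in_IndE [iI]]; rewrite subUset => /andP[_ IE].
  by apply/in_IndE; rewrite subsetD1 IE; split=> //; apply/lin_indep_contract.
move/in_IndE; rewrite subsetD1 => -[iI /andP[IE eI]]; split=> //.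
apply/in_IndE; split; first by apply/(lin_indep_contract Vek).
by rewrite subUset sub1set eE.
Qed.

End Independence.

(** * The upper bound for separated collections *)

Section Separation.
Variables n d : nat.
Implicit Types (V : config n d) (E I J : {set 'I_n}) (S : {set {set 'I_n}}).

Lemma sep_del V S e : Vseparated_coll V S -> Vseparated_coll V (del e S).
Proof.
move=> sS I J /mem_del [eI [b IS]] /mem_del [eJ [c JS]].
have [h [hl [hp hn]]] := sS _ _ IS JS.
exists h; split=> //; split=> i; rewrite in_setD => /andP[i1 i2];
  [apply: hp|apply: hn]; rewrite in_setD !in_addb (negbTE i1) i2 orbT orbF andbT.
all: by apply: contra i1 => /andP[/eqP ie _]; move: i2; rewrite ie ?(negbTE eI) ?(negbTE eJ).
Qed.

(** Separating [I + e] from [J], and [I] from [J + e], gives functionals of opposite signs at [V e].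
    Their positive combination vanishing at [V e] descends to the contraction and still separates
    [I] from [J]. *)
Lemma sep_con V S e k : V e k <> 0 ->
  Vseparated_coll V S -> Vseparated_coll (contract V e k) (con e S).
Proof.
move=> Vek sS I J /mem_con [eI IS] /mem_con [eJ JS].
have [h [hl [hp hn]]] := sS _ _ (IS true) (JS false).
have [g [gl [gp gn]]] := sS _ _ (IS false) (JS true).
have he : h (V e) > 0 by apply: hp; rewrite in_setD !in_addb eqxx (negbTE eJ).
have ge : g (V e) < 0 by apply: gn; rewrite in_setD !in_addb eqxx (negbTE eI).
have ie i : i \in I -> i != e by apply: contraTneq => ->.
have je i : i \in J -> i != e by apply: contraTneq => ->.
pose f y := - g (V e) * h y + h (V e) * g y.
have fl : is_linear_fun f by apply: lin_fun_comb.
have fV i : f (contract V e k i) = f (V i).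
  by rewrite /contract /shadow lin_comb // /f; ring.
exists f; split=> //; split=> i; rewrite in_setD fV => /andP[i1 i2].
- have /hp : i \in addb true e I :\: addb false e J.
    by rewrite in_setD !in_addb i2 (negbTE i1) (negbTE (ie _ i2)).
  have /gp : i \in addb false e I :\: addb true e J.
    by rewrite in_setD !in_addb i2 (negbTE i1) (negbTE (ie _ i2)).
  by rewrite /f; nra.
- have /hn : i \in addb false e J :\: addb true e I.
    by rewrite in_setD !in_addb i2 (negbTE i1) (negbTE (je _ i2)).
  have /gn : i \in addb true e J :\: addb false e I.
    by rewrite in_setD !in_addb i2 (negbTE i1) (negbTE (je _ i2)).
  by rewrite /f; nra.
Qed.

Lemma sep_loop V S e I J : Vseparated_coll V S -> V e = @zpt d ->
  I \in S -> J \in S -> (e \in I) = (e \in J).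
Proof.
move=> sS Ve IS JS; have [h [hl [hp hn]]] := sS _ _ IS JS.
case eI : (e \in I); case eJ : (e \in J) => //.
  have /hp : e \in I :\: J by rewrite in_setD eI eJ.
  by rewrite Ve lin_zpt //; lra.
have /hn : e \in J :\: I by rewrite in_setD eI eJ.
by rewrite Ve lin_zpt //; lra.
Qed.

Lemma con_loop V S e : Vseparated_coll V S -> V e = @zpt d -> con e S = set0.
Proof.
move=> sS Ve; apply/setP => I; rewrite in_set0; apply/negP => /mem_con [eI H].
have := sep_loop sS Ve (H true) (H false).
by rewrite !in_addb eqxx (negbTE eI).
Qed.

Lemma sep_card_le E V S :
  S \subset powerset E -> Vseparated_coll V S -> (#|S| <= #|IndE V E|)%N.
Proof.
elim/set_ind_D1: E V S => [|E e eE IH] V S SE sS.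
  by rewrite IndE0 -powerset0; exact: subset_leq_card.
rewrite (card_del_con e).
have [Ve|[k Vek]] := zpt_or_coord (V e).
  rewrite (con_loop sS Ve) cards0 addn0 (card_IndE_loop E Ve).
  by apply: IH; [exact: del_powerset|exact: sep_del].
rewrite (card_IndE_contract eE Vek); apply: leq_add; apply: IH.
- exact: del_powerset.
- exact: sep_del.
- exact: con_powerset.
- exact: sep_con.
Qed.

End Separation.

(** * Generic hyperplane arrangements and Gordan's alternative *)

Section Arrangements.
Variables n d : nat.
Implicit Types (V : config n d) (E I J : {set 'I_n}) (r : pt n).

(* The hyperplanes [h (V i) = - r i] in the dual space are in general position:
   those with a common point have independent normals. *)
Definition generic V E r := forall I h, I \subset E -> is_linear_fun h ->
  (forall i, i \in I -> h (V i) + r i = 0) -> lin_indep V I.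

(** Offsets are chosen one at a time. If the equations of some [I] containing [e] are solvable for
    two different offsets at [e], the difference of the solutions vanishes on [I - e] but not at
    [V e]; then no relation on [I] involves [e], and independence reduces to [I - e]. So each [I]
    forbids at most one offset. *)
Lemma exists_generic V E : exists r, generic V E r.
Proof.
elim/set_ind_D1: E => [|E e eE [r gr]].
  by exists (@zpt n) => I h; rewrite subset0 => /eqP -> *; exact: lin_indep0.
pose Q (I : {set 'I_n}) M := I \subset E -> e \in I -> forall h, is_linear_fun h ->
  (forall i, i \in I :\ e -> h (V i) + r i = 0) -> h (V e) + M = 0 -> lin_indep V I.
have [|L HL] := @finite_bound _ Q.
  move=> I; have [[M0 [h0 [h0l [h0I h0e]]]]|H] := classic (exists M0 h0, is_linear_fun h0 /\
    (forall i, i \in I :\ e -> h0 (V i) + r i = 0) /\ h0 (V e) + M0 = 0); last first.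
    by exists 0 => M _ _ _ h hl hI he; case: H; exists M, h.
  (* Any threshold beyond the single bad value [M0] would do. *)
  exists (M0 + 1) => M hM IE eI h hl hI he; apply/lin_indepP => a a0 pa.
  have fl : is_linear_fun (fun y => 1 * h y + (-1) * h0 y) by apply: lin_fun_comb.
  have := lin_pmap V a fl; rewrite pa (lin_zpt fl) (bigD1 e) //= big1 => [E1|i ie].
    have ae : a e = 0.
      have /Rmult_integral : a e * (1 * h (V e) + -1 * h0 (V e)) = 0 by lra.
      by case=> // ?; exfalso; lra.
    have /lin_indepP : lin_indep V (I :\ e).
      by apply: (gr _ h) => //; exact: setSD.
    apply=> // i; rewrite !inE negb_and negbK => /orP[/eqP -> //|]; exact: a0.
  have [iI|/a0 ->] := boolP (i \in I); last ring.
  have iIe : i \in I :\ e by rewrite !inE ie.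
  by have := hI i iIe; have := h0I i iIe; nra.
exists (fun i => if i == e then L else r i) => I h IE hl hI.
have [eI|eI] := boolP (e \in I).
  apply: (HL L _ I IE eI h hl); first lra.
    by move=> i; rewrite !inE => /andP[/negbTE ie /hI]; rewrite ie.
  by have := hI e eI; rewrite eqxx.
apply: (gr I h) => // [|i iI]; first by rewrite subsetD1 IE.
have := hI i iI; case: eqP => // ie; by rewrite -ie iI in eI.
Qed.

Definition region V E r I (h : pt d -> R) := is_linear_fun h /\
  forall i, i \in E -> if i \in I then h (V i) + r i > 0 else h (V i) + r i < 0.

Definition regions V E r : {set {set 'I_n}} := [set I in powerset E |
  if excluded_middle_informative (exists h, region V E r I h) then true else false].

Lemma in_regions V E r I :
  I \in regions V E r <-> I \subset E /\ exists h, region V E r I h.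
Proof.
rewrite !inE; case: excluded_middle_informative => H.
  by rewrite andbT; split=> [|[]].
by rewrite andbF; split=> // -[].
Qed.

(** The offsets cancel in the difference of two functionals taken from two regions. *)
Lemma regions_sep V E r : Vseparated_coll V (regions V E r).
Proof.
move=> I J /in_regions [/subsetP IE [h [hl hI]]] /in_regions [/subsetP JE [g [gl gJ]]].
exists (fun y => 1 * h y + (-1) * g y); split; first exact: lin_fun_comb.
split=> i; rewrite in_setD => /andP[i1 i2].
  by have := hI _ (IE _ i2); have := gJ _ (IE _ i2); rewrite i2 (negbTE i1); lra.
by have := hI _ (JE _ i2); have := gJ _ (JE _ i2); rewrite i2 (negbTE i1); lra.
Qed.

Lemma addb_sub b e I E : e \in E -> I \subset E :\ e -> addb b e I \subset E.
Proof.
move=> eE; rewrite subsetD1 => /andP[IE _].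
by case: b => //; rewrite subUset sub1set eE.
Qed.

(** From a point on the hyperplane of [e], a small step along the [k]-th coordinate functional,
    which is nonzero at [V e], reaches either side without crossing the other hyperplanes. *)
Lemma region_cross V E r I h e k b : e \in E -> I \subset E :\ e ->
  region V (E :\ e) r I h -> h (V e) + r e = 0 -> V e k <> 0 ->
  addb b e I \in regions V E r.
Proof.
move=> eE IE [hl hI] he Vek.
have eI : e \notin I by move: IE; rewrite subsetD1 => /andP[].
have [del del0 D] := finite_nbhd (fun i => affine_sign_nbhd (h (V i) + r i) (V i k)).
have [t [td tb]] : exists t, Rabs t < del /\
    if b then t * V e k > 0 else t * V e k < 0.
  have [p|p] : V e k > 0 \/ V e k < 0 by lra.
    exists (if b then del / 2 else - (del / 2)).
    by case: b; split; (try by split_Rabs; lra); nra.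
  exists (if b then - (del / 2) else del / 2).
  by case: b; split; (try by split_Rabs; lra); nra.
apply/in_regions; split; first exact: addb_sub.
exists (fun y => 1 * h y + t * y k); split.
  by apply: lin_fun_comb => //; exact: lin_coord.
move=> i iE; rewrite in_addb; case: (altP (i =P e)) => [->|ie] /=.
  by rewrite (negbTE eI) orbF; move: tb; case: b; lra.
have := hI i; rewrite !inE ie iE => /(_ isT).
by have [] := D t td i; case: (i \in I); lra.
Qed.

Lemma region_extend V E r I h e : e \in E -> I \subset E :\ e ->
  region V (E :\ e) r I h -> h (V e) + r e <> 0 -> exists b, addb b e I \in regions V E r.
Proof.
move=> eE IE [hl hI] he.
have eI : e \notin I by move: IE; rewrite subsetD1 => /andP[].
exists (if Rlt_dec 0 (h (V e) + r e) then true else false).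
apply/in_regions; split; first exact: addb_sub.
exists h; split=> // i iE; rewrite in_addb; case: (altP (i =P e)) => [->|ie] /=.
  by rewrite (negbTE eI) orbF; case: Rlt_dec => /=; lra.
by apply: hI; rewrite !inE ie.
Qed.

Lemma regions_del V E r e : generic V E r -> e \in E ->
  regions V (E :\ e) r \subset del e (regions V E r).
Proof.
move=> gr eE; apply/subsetP => I /in_regions [IE [h hI]]; apply/mem_del.
split; first by move: IE; rewrite subsetD1 => /andP[].
have [he|] := Req_dec (h (V e) + r e) 0; last exact: region_extend hI.
have [Ve|[k Vek]] := zpt_or_coord (V e); last by exists true; exact: region_cross hI he Vek.
(* A loop with offset 0 is impossible: genericity would make the singleton of [e] independent. *)
case: (lin_indep_loop Ve (set11 e)); apply: (gr _ h) => [||i].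
- by rewrite sub1set.
- exact: hI.1.
- by rewrite in_set1 => /eqP ->.
Qed.

(** The offsets of the arrangement induced on the hyperplane of [e], relative to the particular
    solution [- (r e / V e k) * y k]. *)
Definition contract_shift V r e k : pt n := fun i => r i - r e / V e k * V i k.

(* Functionals on the contraction correspond to those with [h (V e) = - r e]. *)
Lemma lift_functional V r e k f : V e k <> 0 -> is_linear_fun f ->
  exists h, [/\ is_linear_fun h, h (V e) + r e = 0 &
    forall i, h (V i) + r i = f (contract V e k i) + contract_shift V r e k i].
Proof.
move=> Vek fl.
exists (fun y => 1 * f (shadow (V e) k y) + (- (r e / V e k)) * y k); split.
- by apply: lin_fun_comb; [exact: lin_shadow|exact: lin_coord].
- by rewrite shadow_self // lin_zpt //; field.
- by move=> i; rewrite /contract_shift /contract; ring.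
Qed.

Lemma generic_contract V E r e k : e \in E -> V e k <> 0 ->
  generic V E r -> generic (contract V e k) (E :\ e) (contract_shift V r e k).
Proof.
move=> eE Vek gr I f; rewrite subsetD1 => /andP[IE eI] fl fI.
apply/(lin_indep_contract Vek) => //.
have [h [hl he hE]] := lift_functional r Vek fl.
apply: (gr _ h) => // [|i]; first by rewrite subUset sub1set eE.
by rewrite !inE => /orP[/eqP -> //|/fI]; rewrite hE.
Qed.

Lemma regions_con V E r e k : e \in E -> V e k <> 0 ->
  regions (contract V e k) (E :\ e) (contract_shift V r e k) \subset con e (regions V E r).
Proof.
move=> eE Vek; apply/subsetP => I /in_regions [IE [f [fl fI]]]; apply/mem_con.
split; first by move: IE; rewrite subsetD1 => /andP[].
move=> b; have [h [hl he hE]] := lift_functional r Vek fl.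
apply: (region_cross b eE IE _ he Vek); split=> // i iE.
by rewrite hE; exact: fI.
Qed.

Lemma card_regions V E r : generic V E r -> (#|IndE V E| <= #|regions V E r|)%N.
Proof.
elim/set_ind_D1: E V r => [|E e eE IH] V r gr.
  rewrite IndE0 cards1 card_gt0; apply/set0Pn; exists set0; apply/in_regions.
  split; first exact: sub0set.
  by exists (fun _ => 0); split; [exact: lin_zero|move=> i; rewrite inE].
have IHd : (#|IndE V (E :\ e)| <= #|del e (regions V E r)|)%N.
  apply: leq_trans (subset_leq_card (regions_del gr eE)); apply: IH.
  by move=> I h IE; apply: gr; apply: subset_trans IE (subsetDl _ _).
rewrite [in X in (_ <= X)%N](card_del_con e).
have [Ve|[k Vek]] := zpt_or_coord (V e).
  by rewrite (card_IndE_loop E Ve); apply: leq_trans IHd (leq_addr _ _).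
rewrite (card_IndE_contract eE Vek); apply: leq_add => //.
apply: leq_trans (subset_leq_card (regions_con r eE Vek)); apply: IH.
exact: generic_contract.
Qed.

(** Elimination of one vector. If [h] is positive on the others but not at [V e], the vectors [W i]
    are combinations of [V e] and [V i] with nonnegative coefficients that [h] kills. A functional
    positive on the [W i] yields one vanishing at [V e] and positive on the other [V i], which is
    then perturbed; a positive relation among the [W i] unfolds to one among the [V i]. *)
Lemma gordan V E :
  (exists h, is_linear_fun h /\ forall i, i \in E -> h (V i) > 0) \/
  (exists a : pt n, [/\ forall i, 0 <= a i, forall i, i \notin E -> a i = 0,
     exists2 i, i \in E & a i > 0 & pmap V a = @zpt d]).
Proof.
elim/set_ind_D1: E V => [|E e eE IH] V.
  by left; exists (fun _ => 0); split; [exact: lin_zero|move=> i; rewrite inE].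
have [[h [hl hE]]|[a [a0 aE [i iE ai] pa]]] := IH V; last first.
  right; exists a; split=> //.
    by move=> j jE; apply: aE; rewrite !inE negb_and jE orbT.
  by exists i => //; move: iE; rewrite !inE => /andP[].
have [he|he] := Rlt_le_dec 0 (h (V e)).
  left; exists h; split=> // i iE; case: (altP (i =P e)) => [->|ie] //.
  by apply: hE; rewrite !inE ie.
have [Ve|[k Vek]] := zpt_or_coord (V e).
  right; exists (bas e); split; last by rewrite pmap_bas.
  - by move=> i; rewrite /bas; case: eqP; lra.
  - by move=> i; rewrite /bas; case: eqP => // ->; rewrite eE.
  - by exists e => //; rewrite /bas eqxx; lra.
pose W : config n d := fun i => comb (h (V i)) (V e) (- h (V e)) (V i).
have [[g [gl gE]]|[a [a0 aE [i0 i0E ai0] pa]]] := IH W.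
  pose f y := - h (V e) * g y + g (V e) * h y.
  have fl : is_linear_fun f by apply: lin_fun_comb.
  have fe : f (V e) = 0 by rewrite /f; ring.
  have fE i : i \in E :\ e -> f (V i) > 0.
    by move=> /gE; rewrite /W lin_comb // /f; lra.
  have [del del0 D] := finite_nbhd (fun i => affine_sign_nbhd (f (V i)) (V i k)).
  have [t [td tb]] : exists t, Rabs t < del /\ t * V e k > 0.
    have [p|p] : V e k > 0 \/ V e k < 0 by lra.
      by exists (del / 2); split; [split_Rabs; lra|nra].
    by exists (- (del / 2)); split; [split_Rabs; lra|nra].
  left; exists (fun y => 1 * f y + t * y k); split.
    by apply: lin_fun_comb => //; exact: lin_coord.
  move=> i iE; case: (altP (i =P e)) => [->|ie]; first by rewrite fe; lra.
  have /fE fi : i \in E :\ e by rewrite !inE ie.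
  by have [/(_ fi) ? _] := D t td i; lra.
have hE' i : i \in E :\ e -> 0 <= a i * h (V i).
  by move=> /hE ?; have := a0 i; nra.
have s0 i : 0 <= a i * h (V i).
  by have [/hE' //|/aE ->] := boolP (i \in E :\ e); lra.
pose s := \big[Rplus/0]_(i < n) (a i * h (V i)).
have spos : s > 0.
  by have := rsum_ge_term i0 s0; have := hE _ i0E; rewrite -/s; nra.
(* Expanding the relation [a] of the [W i] collects the coefficient [s] at [V e]. *)
right; exists (comb (- h (V e)) a s (bas e)); split.
- by move=> i; rewrite /comb /bas; have := a0 i; case: eqP; nra.
- move=> i iE; rewrite /comb /bas aE ?inE ?negb_and ?iE ?orbT //.
  by case: eqP iE => [->|_ _]; [rewrite eE|ring].
- exists e => //; rewrite /comb /bas eqxx aE ?inE ?eqxx //; lra.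
- rewrite pmap_comb pmap_bas; apply: ptP => j; rewrite -pa /pmap /comb big_distrr /=.
  rewrite /s big_distrl /= -big_split /=; apply: eq_bigr => i _.
  by rewrite /W /comb; ring.
Qed.

End Arrangements.

(** * The faces spanned by a separated collection *)

Section FullFaces.
Variables n d : nat.
Implicit Types (V : config n d) (E I J K : {set 'I_n}) (S : {set {set 'I_n}}) (F G : cface n).

(** The largest collection of faces, closed under taking faces, whose vertex labels lie in [S]. *)
Definition full_faces S : {set cface n} :=
  [set F | [forall I : {set 'I_n}, subface (vertex I) F ==> (I \in S)]].

Lemma full_facesP S F :
  reflect (forall I, subface (vertex I) F -> I \in S) (F \in full_faces S).
Proof. by rewrite inE; apply: (iffP forallP) => H I; apply/implyP; exact: H. Qed.

Lemma full_faces_sub S F G : F \in full_faces S -> subface G F -> G \in full_faces S.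
Proof.
move=> /full_facesP H GF; apply/full_facesP => I IG; apply: H.
exact: subface_trans IG GF.
Qed.

Lemma full_faces_mono S S' : S \subset S' -> full_faces S \subset full_faces S'.
Proof.
move=> /subsetP SS'; apply/subsetP => F /full_facesP H; apply/full_facesP => I /H.
exact: SS'.
Qed.

Lemma subface_vertex I J : subface (vertex I) (vertex J) -> I = J.
Proof.
by move/forallP => H; apply/setP => i; have := H i; rewrite !ffunE => /eqP [].
Qed.

Lemma subface_refl F : subface F F.
Proof. by apply/forallP => i; case: (F i) => // b. Qed.

Lemma vertex_full S I : (vertex I \in full_faces S) = (I \in S).
Proof.
apply/full_facesP/idP => [H|IS J /subface_vertex -> //].
exact/H/subface_refl.
Qed.

Lemma Vert_full S : Vert (full_faces S) = S.
Proof. by apply/setP => I; rewrite inE vertex_full. Qed.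

Lemma full_faces_supp S e F : (forall I, I \in S -> e \notin I) ->
  F \in full_faces S -> F e = Some false.
Proof.
move=> He /full_facesP H; case Fe: (F e) => [[]|] //; exfalso.
all: pose I := [set i | if F i is Some b then b else true];
  have /H /He : subface (vertex I) F
  by [apply/forallP => i; rewrite ffunE inE; case: (F i) => //= b; exact: eqxx].
all: by rewrite inE Fe.
Qed.

Definition sign_split (x z : pt n) I J :=
  forall i, (i \in I :\: J <-> x i > z i) /\ (i \in J :\: I <-> x i < z i).

(** Allows one functional, separating two vertices, to control every coordinate of [x - z]. *)
Lemma pick_vertices F G x z : face_pts F x -> face_pts G z ->
  exists I J, [/\ subface (vertex I) F, subface (vertex J) G & sign_split x z I J].
Proof.
move=> Fx Gz.
(* A free coordinate follows the comparison of [x] and [z]. On a tie it copies the other face's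
   fixed value, or [false] if both are free, so that the index enters neither difference set. *)
pose pk (o o' : option bool) a b := if o is Some c then c else
  if Rlt_dec b a then true else if Rlt_dec a b then false else
  if o' is Some c then c else false.
exists [set i | pk (F i) (G i) (x i) (z i)], [set i | pk (G i) (F i) (z i) (x i)].
split.
- by apply/forallP => i; rewrite ffunE inE /pk; case: (F i) => //= b; exact: eqxx.
- by apply/forallP => i; rewrite ffunE inE /pk; case: (G i) => //= b; exact: eqxx.
move=> i; rewrite !inE /pk; move: (Fx i) (Gz i).
case: (F i) => [[]|]; case: (G i) => [[]|] Hx Hz /=;
  do 2?[case: Rlt_dec => ? /=]; split; split=> h; first [done | lra | exfalso; lra].
Qed.

(** Each nonzero coordinate of [x - z] has the sign of [h] at its vector, so nothing cancels. This
    identity gives the injectivity, the Lipschitz inverse and the sign of heights in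
    [side_vertex]. *)
Lemma sign_gap V x z h : is_linear_fun h ->
  (forall i, x i > z i -> h (V i) > 0) -> (forall i, x i < z i -> h (V i) < 0) ->
  h (pmap V x) - h (pmap V z) = \big[Rplus/0]_(i < n) (Rabs (x i - z i) * Rabs (h (V i))).
Proof.
move=> hl hp hn.
have -> : h (pmap V x) - h (pmap V z) = h (pmap V (comb 1 x (-1) z)).
  by rewrite pmap_comb lin_comb //; ring.
rewrite lin_pmap //; apply: eq_bigr => i _; rewrite /comb.
have [E|[|]] : x i = z i \/ (x i > z i \/ x i < z i) by lra.
- by rewrite E Rminus_diag Rabs_R0; ring.
- by move=> c; have := hp i c => c'; rewrite !Rabs_pos_eq; lra.
- by move=> c; have := hn i c => c'; rewrite !Rabs_left; lra.
Qed.

Lemma sep_sign_split V S I J : Vseparated_coll V S -> I \in S -> J \in S ->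
  exists2 h, is_linear_fun h & forall x z, sign_split x z I J ->
    (forall i, x i > z i -> h (V i) > 0) /\ (forall i, x i < z i -> h (V i) < 0).
Proof.
move=> sS IS JS; have [h [hl [hp hn]]] := sS _ _ IS JS.
exists h => // x z H; split=> i xz; first by apply: hp; apply/(H i).1.
by apply: hn; apply/(H i).2.
Qed.

Lemma full_faces_inj V S : Vseparated_coll V S -> cover_inj V (full_faces S).
Proof.
move=> sS x z [F /full_facesP FS Fx] [G /full_facesP GS Gz] pxz.
have [I [J [/FS IS /GS JS H]]] := pick_vertices Fx Gz.
have [h hl /(_ _ _ H) [hp hn]] := sep_sign_split sS IS JS.
have := sign_gap hl hp hn; rewrite pxz Rminus_diag => /esym s0.
apply: ptP => i.
have ti : Rabs (x i - z i) * Rabs (h (V i)) = 0.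
  by apply: rsum_eq0 s0 i => j; apply: Rmult_le_pos; exact: Rabs_pos.
have [E|[|]] : x i = z i \/ (x i > z i \/ x i < z i) by lra.
- by [].
- move=> c; have := hp i c => c'; move: ti; rewrite !Rabs_pos_eq; nra.
- move=> c; have := hn i c => c'; move: ti; rewrite !Rabs_left; nra.
Qed.

Lemma dist_ge0 k (x y : pt k) : 0 <= dist x y.
Proof.
apply: big_ind => [|a b ? ?|i _]; [lra| |exact: Rabs_pos].
by have := Rmax_l a b; lra.
Qed.

Lemma dist_ge k (x y : pt k) i : Rabs (x i - y i) <= dist x y.
Proof.
rewrite /dist; have: i \in index_enum 'I_k by exact: mem_index_enum.
elim: (index_enum _) => // j s IH; rewrite inE big_cons.
set m := \big[Rmax/0]_(_ <- s) _ in IH *.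
have [ml mr] := (Rmax_l (Rabs (x j - y j)) m, Rmax_r (Rabs (x j - y j)) m).
by move=> /orP[/eqP ->|/IH]; lra.
Qed.

Lemma dist_lt k (x y : pt k) eps : eps > 0 ->
  (forall i, Rabs (x i - y i) < eps) -> dist x y < eps.
Proof. by move=> e0 H; apply: (big_ind (fun r => r < eps)) => // *; exact: Rmax_lub_lt. Qed.

Lemma lin_bound k (h : pt k -> R) : is_linear_fun h ->
  exists L, forall M, L <= M -> forall y y', Rabs (h y - h y') <= M * dist y y'.
Proof.
move=> hl; exists (\big[Rplus/0]_(i < k) Rabs (h (bas i))) => M hM y y'.
have hE u : h u = \big[Rplus/0]_(i < k) (u i * h (bas i)).
  rewrite -(lin_pmap (fun i => bas i)) //; congr h; apply: ptP => j.
  rewrite /pmap (bigD1 j) //= big1 /bas ?eqxx; first ring.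
  by move=> i; rewrite eq_sym => /negbTE ->; ring.
have -> : h y - h y' = \big[Rplus/0]_(i < k) ((y i - y' i) * h (bas i)).
  have -> : h y - h y' = h (comb 1 y (-1) y') by rewrite lin_comb //; ring.
  by rewrite hE; apply: eq_bigr => i _; rewrite /comb; ring.
apply: Rle_trans (rsum_abs _) _.
apply: (Rle_trans _ (\big[Rplus/0]_(i < k) Rabs (h (bas i)) * dist y y')).
  rewrite big_distrl /=; apply: (big_ind2 Rle) => [|*|i _]; [lra|lra|].
  rewrite Rabs_mult Rmult_comm; apply: Rmult_le_compat_l; first exact: Rabs_pos.
  exact: dist_ge.
by apply: Rmult_le_compat_r => //; exact: dist_ge0.
Qed.

Lemma pmap_lipschitz V :
  exists L, forall x z i, Rabs (pmap V x i - pmap V z i) <= L * dist x z.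
Proof.
have [|L HL] := @finite_bound _ (fun i M => forall x z : pt n,
    Rabs (pmap V x i - pmap V z i) <= M * dist x z).
  move=> i; apply: (@lin_bound n (fun x => pmap V x i)).
  by apply: lin_of_comb => a x b y; rewrite pmap_comb.
by exists L => x z i; apply: HL; lra.
Qed.

(** The separating functional depends only on the two chosen vertices, so finitely many constants
    suffice; where it vanishes at [V i], coordinate [i] cannot differ at all. *)
Lemma full_faces_lipschitz V S : Vseparated_coll V S ->
  exists L, forall x z, cover (full_faces S) x -> cover (full_faces S) z ->
    forall i, Rabs (x i - z i) <= L * dist (pmap V x) (pmap V z).
Proof.
move=> sS.
pose Q (p : {set 'I_n} * {set 'I_n} * 'I_n) M := p.1.1 \in S -> p.1.2 \in S ->
  forall x z, sign_split x z p.1.1 p.1.2 ->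
  Rabs (x p.2 - z p.2) <= M * dist (pmap V x) (pmap V z).
have [|L HL] := @finite_bound _ Q.
  move=> [[I J] i]; rewrite /Q /=.
  have [IS|IS] := boolP (I \in S); last by exists 0.
  have [JS|JS] := boolP (J \in S); last by exists 0.
  have [h hl H] := sep_sign_split sS IS JS.
  have [L HL] := lin_bound hl.
  have [i0|i0] := Req_dec (h (V i)) 0.
    exists 0 => M M0 _ _ x z xz; have [hp hn] := H x z xz.
    have -> : x i = z i.
      have [//|[/hp|/hn]] : x i = z i \/ (x i > z i \/ x i < z i) by lra.
        by rewrite i0; lra.
      by rewrite i0; lra.
    rewrite Rminus_diag Rabs_R0; apply: Rmult_le_pos => //; exact: dist_ge0.
  have c0 := Rabs_pos_lt _ i0.
  exists (Rmax L 0 / Rabs (h (V i))) => M hM _ _ x z xz; have [hp hn] := H x z xz.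
  have := HL (Rmax L 0) (Rmax_l _ _) (pmap V x) (pmap V z).
  rewrite (sign_gap hl hp hn) => /(Rle_trans _ _ _ (Rle_abs _)) le1.
  have := rsum_ge_term i (f := fun i => Rabs (x i - z i) * Rabs (h (V i))) => /(_ _)/Rle_trans.
  move=> /(_ _ _ le1) le2; have {}le2 := le2 (fun j => Rmult_le_pos _ _ (Rabs_pos _) (Rabs_pos _)).
  have D0 := dist_ge0 (pmap V x) (pmap V z).
  apply: (Rle_trans _ (Rmax L 0 / Rabs (h (V i)) * dist (pmap V x) (pmap V z))); last first.
    exact: Rmult_le_compat_r.
  apply: (Rmult_le_reg_r (Rabs (h (V i)))) => //.
  by apply: Rle_trans le2 _; apply: Req_le; field; lra.
exists L => x z [F /full_facesP FS Fx] [G /full_facesP GS Gz] i.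
have [I [J [/FS IS /GS JS H]]] := pick_vertices Fx Gz.
by apply: (HL L _ (I, J, i)) => //; lra.
Qed.

End FullFaces.

(** * Lifting faces along a removed coordinate *)

Section Lifting.
Variable n : nat.
Implicit Types (E I J K : {set 'I_n}) (S : {set {set 'I_n}}) (F G : cface n) (e : 'I_n).

Definition upd F e (o : option bool) : cface n := [ffun i => if i == e then o else F i].
Definition setc (x : pt n) e (t : R) : pt n := fun i => if i == e then t else x i.
Definition incube E (x : pt n) :=
  (forall i, 0 <= x i <= 1) /\ (forall i, i \notin E -> x i = 0).
Definition bpt (b : bool) : R := if b then 1 else 0.

Lemma setc_comb x e t : setc x e t = comb 1 x (t - x e) (bas e).
Proof. by apply: ptP => i; rewrite /setc /comb /bas; case: eqP => [->|_]; ring. Qed.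

Lemma pmap_setc d (V : config n d) x e t :
  pmap V (setc x e t) = comb 1 (pmap V x) (t - x e) (V e).
Proof. by rewrite setc_comb pmap_comb pmap_bas. Qed.

Lemma incube_comb E x z t : incube E x -> incube E z -> 0 <= t <= 1 ->
  incube E (comb (1 - t) x t z).
Proof.
move=> [hx sx] [hz sz] ht; split=> i; rewrite /comb.
  by have := hx i; have := hz i; nra.
by move=> iE; rewrite sx // sz //; ring.
Qed.

Lemma incube_setc E x e : incube E x -> incube (E :\ e) (setc x e 0).
Proof.
move=> [hx sx]; split=> i; rewrite /setc; case: (altP (i =P e)) => // ie; first lra.
by rewrite !inE ie => /sx.
Qed.

Lemma incube_cover E S x : S \subset powerset E -> cover (full_faces S) x -> incube E x.
Proof.
move=> /subsetP SE [F FS Fx]; split=> i; first exact: face_pts_cube Fx i.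
move=> iE; have := Fx i; rewrite (full_faces_supp _ FS) // => I /SE.
by rewrite powersetE => /subsetP IE; apply: contra iE; exact: IE.
Qed.

Lemma del_supp e S I : I \in del e S -> e \notin I.
Proof. by move/mem_del => []. Qed.

Lemma con_supp e S I : I \in con e S -> e \notin I.
Proof. by move/mem_con => []. Qed.

Lemma subface_upd F e o I : F e = Some false -> subface (vertex I) (upd F e o) ->
  subface (vertex (I :\ e)) F.
Proof.
move=> Fe /forallP H; apply/forallP => i; have := H i; rewrite !ffunE !inE.
by case: (altP (i =P e)) => [->|//]; rewrite Fe.
Qed.

(** The prism over a face of the section. *)
Lemma upd_con e S F : F \in full_faces (con e S) -> upd F e None \in full_faces S.
Proof.
move=> FS; have Fe := full_faces_supp (@con_supp e S) FS.
apply/full_facesP => I /(subface_upd Fe) /(elimT (full_facesP _ _) FS) /mem_con [_].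
move=> /(_ (e \in I)); rewrite /addb; case: ifP => eI; first by rewrite setD1K.
by rewrite (setDidPl _) // disjoint_sym disjoints1 eI.
Qed.

Lemma upd_side b e S F : F e = Some false ->
  (forall K, subface (vertex K) F -> addb b e K \in S) ->
  upd F e (Some b) \in full_faces S.
Proof.
move=> Fe H; apply/full_facesP => I sI; have := H _ (subface_upd Fe sI).
have : (e \in I) = b by move/forallP/(_ e): sI; rewrite !ffunE eqxx => /eqP[].
case: b {H sI} => /= eI; first by rewrite setD1K.
by rewrite (setDidPl _) // disjoint_sym disjoints1 eI.
Qed.

Lemma face_pts_upd F x e o t : face_pts F x ->
  (match o with Some b => t = bpt b | None => 0 <= t <= 1 end) ->
  face_pts (upd F e o) (setc x e t).
Proof.
move=> Fx ot i; rewrite ffunE /setc; case: (altP (i =P e)) => _; last exact: Fx.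
by move: ot; case: o => [[]|].
Qed.

(** Since [s < 1], the point [x] has positive weight, so a coordinate that [G] fixes at an end of
    [0,1] has the same value at [x]. *)
Lemma subface_carrier_comb G x y s : face_pts G (comb (1 - s) x s y) ->
  0 <= s < 1 -> (forall i, 0 <= x i <= 1) -> (forall i, 0 <= y i <= 1) ->
  subface (carrier x) G.
Proof.
move=> Gc hs hx hy; apply/forallP => i; move: (Gc i) (hx i) (hy i).
rewrite /comb ffunE; case: (G i) => [[]|] // E xi yi.
  have -> : x i = 1 by nra.
  by carrier_cases.
have -> : x i = 0 by nra.
by carrier_cases.
Qed.

End Lifting.

(** * The spanned faces of an extremal collection cover the zonotope *)

Section Surjectivity.
Variables n d : nat.
Implicit Types (V : config n d) (E I J K : {set 'I_n}) (S : {set {set 'I_n}}) (F G : cface n).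

Definition signed (b : bool) (t : R) := if b then t > 0 else t < 0.

Lemma zero_crossing t t' : (t > 0 /\ t' <= 0) \/ (t < 0 /\ t' >= 0) ->
  exists2 l, 0 < l <= 1 & (1 - l) * t + l * t' = 0.
Proof.
move=> H; have tt' : t - t' <> 0 by lra.
have lE : t / (t - t') * (t - t') = t by field.
exists (t / (t - t')); last by field.
by split; [apply: Rnot_le_lt|apply: Rnot_lt_le] => hl; case: H => -[? ?]; nra.
Qed.

Lemma conv_lt1 l s s' : 0 < l <= 1 -> 0 <= s < 1 -> s <= s' <= 1 ->
  s' < 1 \/ l < 1 -> 0 <= (1 - l) * s + l * s' < 1.
Proof. by move=> hl hs hs' [?|?]; split; nra. Qed.

Lemma sep_addb V S e I J b : Vseparated_coll V S -> e \notin I -> e \notin J ->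
  addb (~~ b) e I \in S -> addb b e J \in S ->
  exists h, [/\ is_linear_fun h, signed (~~ b) (h (V e)) &
    forall x z, sign_split x z I J ->
    (forall i, x i > z i -> h (V i) > 0) /\ (forall i, x i < z i -> h (V i) < 0)].
Proof.
move=> sS eI eJ IS JS; have [h [hl [hp hn]]] := sS _ _ IS JS.
exists h; split=> //.
  case: b {IS JS} hp hn => hp hn; [apply: hn|apply: hp].
    by rewrite in_setD !in_addb eqxx (negbTE eI).
  by rewrite in_setD !in_addb eqxx (negbTE eJ).
move=> x z H; split=> i xz.
  have := (H i).1.2 xz; rewrite in_setD => /andP[i1 i2].
  apply: hp; rewrite in_setD !in_addb (negbTE i1) i2 orbT orbF andbT negb_and.
  by have -> : i != e by apply: contraNneq eI => <-.
have := (H i).2.2 xz; rewrite in_setD => /andP[i1 i2].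
apply: hn; rewrite in_setD !in_addb (negbTE i1) i2 orbT orbF andbT negb_and.
by have -> : i != e by apply: contraNneq eJ => <-.
Qed.

(** Were [K] lifted to the other side only, separating that lift from the side-[b] lift of a vertex
    of the section would give [h] with the sign opposite to [b] at [V e], while [sign_gap] makes
    [tau * h (V e)] nonnegative. *)
Lemma side_vertex V S e K w b tau : Vseparated_coll V S ->
  K \in del e S -> cover (full_faces (con e S)) w ->
  pmap V (vpt K) = comb 1 (pmap V w) tau (V e) -> signed b tau -> addb b e K \in S.
Proof.
move=> sS /mem_del [eK [c KS]] [F /full_facesP FS Fw] pK tb.
have [<-//|cb] := eqVneq c b.
have KS' : addb (~~ b) e K \in S by move: cb KS; case: b {tb}; case: c.
have Kv : face_pts (vertex K) (vpt K) by apply/face_pts_vpt; exact: subface_refl.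
have [I [J [/subface_vertex EI /FS /mem_con [eJ JS] H]]] := pick_vertices Kv Fw.
rewrite {I}EI in H.
have [h [hl he /(_ _ _ H) [hp hn]]] := sep_addb sS eK eJ KS' (JS b).
have := sign_gap hl hp hn; rewrite pK lin_comb // => E.
have : 0 <= tau * h (V e).
  have -> : tau * h (V e) = 1 * h (pmap V w) + tau * h (V e) - h (pmap V w) by ring.
  by rewrite E; apply: rsum_ge0 => i; apply: Rmult_le_pos; exact: Rabs_pos.
by move: tb he; rewrite /signed; case: (b) => /=; nra.
Qed.

(** On the way from [z] to a vertex of its carrier, the strict side can be lost only by meeting the
    section. A meeting before the end puts the whole carrier of [z] into the section, where both
    lifts exist; a meeting at the end puts the vertex itself there. *)
Lemma side_face V S E e k b z w tau : Vseparated_coll V S -> S \subset powerset E ->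
  V e k <> 0 ->
  (forall x, incube (E :\ e) x -> exists2 a, cover (full_faces (con e S)) a &
     pmap (contract V e k) a = pmap (contract V e k) x) ->
  cover (full_faces (del e S)) z -> cover (full_faces (con e S)) w ->
  pmap V z = comb 1 (pmap V w) tau (V e) -> signed b tau ->
  forall K, subface (vertex K) (carrier z) -> addb b e K \in S.
Proof.
move=> sS SE Vek surj Cz Cw pz tb K sK.
have injd := full_faces_inj (sep_del (e := e) sS).
have injc := full_faces_inj (sep_con Vek sS).
have cz : incube (E :\ e) z := incube_cover (del_powerset e SE) Cz.
have [cz1 _] := cz.
have czT : carrier z \in full_faces (del e S).
  by case: Cz => F FT Fz; apply: full_faces_sub FT _; exact: carrier_subface.
have KS : K \in del e S by move/full_facesP: czT; apply.
have KT : cover (full_faces (del e S)) (vpt K).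
  by exists (vertex K); rewrite ?vertex_full //; apply/face_pts_vpt; exact: subface_refl.
have con_del : full_faces (con e S) \subset full_faces (del e S).
  by apply: full_faces_mono; exact: sub_con_del.
have cK : incube (E :\ e) (vpt K) := incube_cover (del_powerset e SE) KT.
have con_done : K \in con e S -> addb b e K \in S by move/mem_con => [_].
have [a Ca /esym pa] := surj _ cK.
pose q s := comb (1 - s) z s (vpt K).
pose y := pmap (contract V e k) z.
pose W := comb 1 (pmap (contract V e k) (vpt K)) (-1) y.
have pq s : pmap (contract V e k) (q s) = comb 1 y s W.
  by rewrite pmap_comb; apply: ptP => i; rewrite /W /y /comb; ring.
have q1 : q 1 = vpt K by apply: ptP => i; rewrite /q /comb; ring.
have q0 : q 0 = z by apply: ptP => i; rewrite /q /comb; ring.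
(* [P s a]: the point [q s] of the segment from [z] to [vpt K] is on the side
   [b] of the point [a] of the lower-dimensional tiling below it, unless the
   face containing [z] belongs to that tiling. *)
pose P s a := carrier z \in full_faces (con e S) \/
  exists2 t, pmap V (q s) = comb 1 (pmap V a) t (V e) & signed b t \/ (s = 1 /\ t = 0).
have : P 1 a.
  apply: (path_invariant (V := contract V e k) (y := y) (w := W) injc Cw) => //.
  - by apply/pmap_contract_eq => //; exists tau.
  - by rewrite -pa -q1 pq.
  - by move=> s hs; rewrite -pq; apply: surj; exact: incube_comb.
  - by right; rewrite q0; exists tau => //; left.
  move=> s s' G u v s0 ss' s1 GT Gu Gv pu pv; rewrite /P.
  case=> [|[t pt_ tP]]; first by left.
  have [[s1' t0]|st] := classic (s = 1 /\ t = 0).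
    have ss : s' = s by lra.
    have uv : u = v by apply: injc; [exists G|exists G|rewrite pu pv ss].
    by right; exists t; [rewrite -uv ss|right; rewrite ss].
  have {tP} tP : signed b t by case: tP.
  have := pq s'; rewrite -pv => /esym /pmap_contract_eq => /(_ Vek) [t' pt'].
  have [tP'|ntP'] := classic (signed b t'); first by right; exists t' => //; left.
  have [[s1' t0']|st'] := classic (s' = 1 /\ t' = 0).
    by right; exists t' => //; right.
  have sgn : (t > 0 /\ t' <= 0) \/ (t < 0 /\ t' >= 0).
    by move: tP ntP'; rewrite /signed; case: (b) => ? ?; [left|right]; lra.
  have tt' : t <> t' by lra.
  have [l l01 lE] := zero_crossing sgn.
  pose s2 := (1 - l) * s + l * s'.
  (* At [s = 1] the step has length 0, so both heights agree and no sign change is possible. *)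
  have [slt|seq] : s < 1 \/ s = 1 by [lra]; last first.
    have ss : s' = s by lra.
    have uv : u = v by apply: injc; [exists G|exists G|rewrite pu pv ss].
    have := pt'; rewrite ss -uv pt_ => /eq_at/(_ k); rewrite /comb => tt.
    have /Rmult_integral : (t - t') * V e k = 0 by lra.
    by case=> // ?; exfalso; lra.
  have s2lt : 0 <= s2 < 1.
    apply: conv_lt1; [by []|lra|lra|]; have [s'lt|s'e] : s' < 1 \/ s' = 1 by [lra]; first by left.
    right; have t'0 : t' <> 0 by move=> t'0; apply: st'.
    suff ? : l <> 1 by lra.
    by move=> l1; apply: t'0; rewrite l1 in lE; lra.
  have cG : face_pts G (comb (1 - l) u l v) by apply: face_pts_comb => //; lra.
  (* At height 0 the point of [G] and the point of the segment have the same image; both lie in the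
     deletion tiling, so they coincide and [G] contains the carrier of [z]. *)
  have E2 : comb (1 - l) u l v = q s2.
    apply: injd.
    - by exists G => //; exact: (subsetP con_del).
    - exists (carrier z) => //; apply: face_pts_comb; last lra.
        exact: face_pts_carrier.
      exact/face_pts_vpt.
    have -> : q s2 = comb (1 - l) (q s) l (q s').
      by apply: ptP => i; rewrite /q /s2 /comb; ring.
    rewrite (pmap_comb V (1 - l) u) (pmap_comb V (1 - l) (q s)) pt_ pt'.
    apply: ptP => i; rewrite /comb.
    have -> : (1 - l) * (1 * pmap V u i + t * V e i) + l * (1 * pmap V v i + t' * V e i) =
      (1 - l) * pmap V u i + l * pmap V v i + ((1 - l) * t + l * t') * V e i by ring.
    by rewrite lE; ring.
  left; apply: full_faces_sub GT _; rewrite E2 in cG.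
  by apply: subface_carrier_comb cG _ _ _ => // i; exact: cK.1.
case=> [/full_facesP/(_ K sK) //|[t]]; rewrite q1 => pt_ [tP|[_ t0]].
  exact: side_vertex Ca pt_ tP.
apply: con_done; have Ea : vpt K = a.
  apply: injd => //.
    by case: Ca => G GT Ga; exists G => //; exact: (subsetP con_del).
  by rewrite pt_ t0; apply: ptP => i; rewrite /comb; ring.
by case: Ca => G /full_facesP GT; rewrite -Ea => /face_pts_vpt/GT.
Qed.

Lemma leq_add_eq (a b a' b' : nat) : (a + b = a' + b' -> b' <= b -> a' <= a ->
  a' = a /\ b' = b)%N.
Proof. by lia. Qed.

(** Equality in the bound is inherited by [del e S] and [con e S], as each term of the recursion is
    bounded separately. The image of [x] is then located by its height above the section. *)
Lemma full_faces_surj E V S : S \subset powerset E -> Vseparated_coll V S ->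
  #|S| = #|IndE V E| -> forall x, incube E x ->
  exists2 z, cover (full_faces S) z & pmap V z = pmap V x.
Proof.
elim/set_ind_D1: E V S => [|E e eE IH] V S SE sS cS x cx.
  have S0 : S = [set set0].
    apply/eqP; rewrite eqEcard cS IndE0 cards1 leqnn andbT.
    by move: SE; rewrite powerset0.
  exists x => //; exists (vertex set0); first by rewrite vertex_full S0 set11.
  by move=> i; rewrite ffunE inE; apply: cx.2; rewrite inE.
have dSE := del_powerset e SE; have cSE := con_powerset e SE.
have sD := sep_del (e := e) sS.
pose x0 := setc x e 0.
have cx0 : incube (E :\ e) x0 by exact: incube_setc.
have supp0 z : cover (full_faces (del e S)) z -> z e = 0.
  by move/(incube_cover dSE) => [_]; apply; rewrite !inE eqxx.
have [Ve|[k Vek]] := zpt_or_coord (V e).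
  have dC : #|del e S| = #|IndE V (E :\ e)|.
    have := card_del_con e S; rewrite (con_loop sS Ve) cards0 addn0 => <-.
    by rewrite cS (card_IndE_loop E Ve).
  have [z Cz pz] := IH _ _ dSE sD dC _ cx0.
  have ze := supp0 z Cz; case: Cz => F FT Fz.
  have Fe := full_faces_supp (@del_supp _ e S) FT.
  have FT' := elimT (full_facesP _ _) FT.
  have sF : subface (vertex [set i | F i == Some true]) F.
    by apply/forallP => i; rewrite ffunE inE; case: (F i) => // -[].
  have /mem_del [_ [b bS]] := FT' _ sF.
  (* Coordinate [e] of a loop does not affect the image, and all members of [S] agree on a loop, so
     one [b] serves every vertex of [F]. *)
  exists (setc z e (bpt b)).
    exists (upd F e (Some b)); last exact: face_pts_upd.
    apply: upd_side => // K /FT' /mem_del [eK [c KS]].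
    suff <- : c = b by [].
    have := sep_loop sS Ve KS bS.
    by rewrite !in_addb eqxx /= (negbTE eK) inE Fe !orbF.
  rewrite pmap_setc pz pmap_setc Ve; apply: ptP => i; rewrite /comb /zpt; ring.
have sC := sep_con Vek sS.
have cD := card_del_con e S.
have [dE cE] : #|del e S| = #|IndE V (E :\ e)| /\
    #|con e S| = #|IndE (contract V e k) (E :\ e)|.
  have := sep_card_le dSE sD; have := sep_card_le cSE sC.
  move: cD; rewrite cS (card_IndE_contract eE Vek); exact: leq_add_eq.
have surjD := IH _ _ dSE sD dE; have surjC := IH _ _ cSE sC cE.
have [w Cw /(pmap_contract_eq _ _ Vek) [tau pw]] := surjC _ cx0.
have Cw' : cover (full_faces (del e S)) w.
  case: Cw => F FT Fw; exists F => //.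
  by apply: (subsetP (full_faces_mono _)) FT; exact: sub_con_del.
have cw := incube_cover cSE Cw.
have xE : pmap V x = comb 1 (pmap V x0) (x e) (V e).
  by rewrite pmap_setc; apply: ptP => i; rewrite /comb; ring.
have side b m t : incube (E :\ e) m -> pmap V m = comb 1 (pmap V w) t (V e) ->
    signed b t -> exists2 z, cover (full_faces S) z &
    pmap V z = comb 1 (pmap V m) (bpt b) (V e).
  move=> cm pm tb; have [z Cz pz] := surjD _ cm.
  have ze := supp0 z Cz.
  exists (setc z e (bpt b)); last by rewrite pmap_setc pz ze Rminus_0_r.
  have cz := incube_cover dSE Cz.
  exists (upd (carrier z) e (Some b)).
    apply: upd_side; first by rewrite ffunE ze; carrier_cases.
    by apply: (side_face sS SE Vek surjC Cz Cw _ tb); rewrite pz.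
  apply: face_pts_upd => //; exact: face_pts_carrier cz.1.
have xe := cx.1 e.
(* The height of the target is [tau + x e]: in [0,1] it lies in the prism over [w]. Otherwise, after
   subtracting [V e] if it is above 1, it lies on the segment between the images of [w] and [x0],
   hence in the deletion zonotope and strictly on one side; [l] is its ratio on that segment. *)
have [t1|[t0|t01]] : tau + x e > 1 \/ (tau + x e < 0 \/ 0 <= tau + x e <= 1) by lra.
- pose l := (tau + x e - 1) / tau.
  have lt : l * tau = tau + x e - 1 by rewrite /l; field; lra.
  have l01 : 0 <= l <= 1 by nra.
  have [||| z Cz pz] := side true (comb (1 - l) w l x0) (tau + x e - 1).
  + exact: incube_comb.
  + by rewrite pmap_comb pw -lt; apply: ptP => i; rewrite /comb; ring.
  + by rewrite /signed; lra.
  exists z => //; rewrite pz xE pmap_comb pw; apply: ptP => i; rewrite /comb /bpt.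
  have -> : tau = 1 - x e + l * tau by lra.
  by ring_simplify; nra.
- pose l := (tau + x e) / tau.
  have lt : l * tau = tau + x e by rewrite /l; field; lra.
  have l01 : 0 <= l <= 1 by nra.
  have [||| z Cz pz] := side false (comb (1 - l) w l x0) (tau + x e).
  + exact: incube_comb.
  + by rewrite pmap_comb pw -lt; apply: ptP => i; rewrite /comb; ring.
  + by rewrite /signed; lra.
  exists z => //; rewrite pz xE pmap_comb pw; apply: ptP => i; rewrite /comb /bpt.
  have -> : x e = l * tau - tau by lra.
  ring.
- exists (setc w e (tau + x e)).
    case: Cw => F FT Fw; exists (upd F e None); first exact: upd_con.
    exact: face_pts_upd.
  rewrite pmap_setc (supp0 _ Cw') xE pw; apply: ptP => i; rewrite /comb; ring.
Qed.

End Surjectivity.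

(** * Deletion and contraction of tilings *)

Section Tilings.
Variables n d : nat.
Implicit Types (V : config n d) (E I J K : {set 'I_n}) (F G : cface n) (T : {set cface n}).

(* A fine tiling of the zonotope of the vectors indexed by [E], without the
   topology: continuity of the inverse is automatic. *)
Definition tiling V E T := [/\ forall F G, F \in T -> subface G F -> G \in T,
  forall F i, F \in T -> i \notin E -> F i = Some false, cover_inj V T &
  forall x, incube E x -> exists2 z, cover T z & pmap V z = pmap V x].

Lemma fine_tilingW V T : fine_tiling V T -> tiling V setT T.
Proof.
move=> [cl [_ [surj [inj _]]]]; split=> //; first by move=> F i; rewrite inE.
move=> x [hx _]; have [|z [Tz pz]] := surj (pmap V x); first by exists x.
by exists z.
Qed.

Lemma cover_incube V E T x : tiling V E T -> cover T x -> incube E x.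
Proof.
move=> [_ supp _ _] [F FT Fx]; split=> i; first exact: face_pts_cube Fx i.
by move=> iE; have := Fx i; rewrite (supp F).
Qed.

Lemma incube_setE E x e t : e \in E -> incube E x -> 0 <= t <= 1 -> incube E (setc x e t).
Proof.
move=> eE [hx sx] ht; split=> i; rewrite /setc; first by case: eqP.
by case: eqP => [->|_]; [rewrite eE|exact: sx].
Qed.

Lemma incube_sub E E' x : E \subset E' -> incube E x -> incube E' x.
Proof.
move=> /subsetP EE' [hx sx]; split=> // i iE; apply: sx.
by apply: contra iE; exact: EE'.
Qed.

(** If [e] is free in [G], injectivity allows only the straight motion along coordinate [e]; if it
    is fixed, that coordinate does not change. *)
Lemma cell_move V G a b e t : face_inj V G -> face_pts G a -> face_pts G b ->
  pmap V b = comb 1 (pmap V a) t (V e) -> 0 <= t ->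
  0 <= b e - a e <= t /\ (b e - a e = t -> b = comb 1 a t (bas e)).
Proof.
move=> inj Ga Gb pb t0; case Ge: (G e) => [c|].
  have ab : a e = b e by move: (Ga e) (Gb e); rewrite Ge; case: c {Ge} => -> ->.
  split=> [|bat]; first lra.
  have t00 : t = 0 by lra.
  rewrite t00; have -> : b = a.
    by apply: inj => //; rewrite pb t00; apply: ptP => i; rewrite /comb; ring.
  by apply: ptP => i; rewrite /comb; ring.
have /eq_at E : comb 1 b (-1) (comb 1 a t (bas e)) = @zpt n.
  apply: (face_free_inj inj) => [i Gi|].
    move: (Ga i) (Gb i); rewrite /comb /bas; case: eqP => [ie|_].
      by rewrite ie Ge in Gi.
    by case: (G i) Gi => [[]|] // _ -> ->; ring.
  by rewrite !pmap_comb pb pmap_bas; apply: ptP => i; rewrite /comb /zpt; ring.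
have bE : b = comb 1 a t (bas e).
  by apply: ptP => i; have := E i; rewrite /comb /zpt; lra.
by split=> //; rewrite bE /comb /bas eqxx; lra.
Qed.

Lemma tiling_path V E T x z s : tiling V E T -> cover T x -> cover T z ->
  0 <= s <= 1 -> exists2 a, cover T a &
  pmap V a = comb 1 (pmap V x) s (comb 1 (pmap V z) (-1) (pmap V x)).
Proof.
move=> tT Tx Tz hs; have [_ _ _ surj] := tT.
have [|a Ta pa] := surj (comb (1 - s) x s z).
  by apply: incube_comb => //; exact: cover_incube tT _.
exists a => //; rewrite pa pmap_comb; apply: ptP => i; rewrite /comb; ring.
Qed.

(** Chains [cell_move] through the tiles. The equality case yields injectivity for the deletion;
    monotonicity yields it for the contraction. *)
Lemma tiling_slope V E T x z e tau : tiling V E T -> cover T x -> cover T z ->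
  pmap V z = comb 1 (pmap V x) tau (V e) -> 0 <= tau ->
  0 <= z e - x e <= tau /\ (z e - x e = tau -> z = comb 1 x tau (bas e)).
Proof.
move=> tT Tx Tz pz t0; have [_ _ inj _] := tT.
pose P s a := 0 <= a e - x e <= s * tau /\
  (a e - x e = s * tau -> a = comb 1 x (s * tau) (bas e)).
suff : P 1 z by rewrite /P Rmult_1_l.
apply: (path_invariant inj Tx erefl Tz (w := comb 1 (pmap V z) (-1) (pmap V x))).
- by apply: ptP => i; rewrite /comb; ring.
- by move=> s hs; exact: tiling_path tT Tx Tz hs.
- by split=> [|_]; [lra|apply: ptP => i; rewrite /comb; ring].
move=> s s' G a b s0 ss' s1 GT Ga Gb pa pb [aP aE].
have st : 0 <= (s' - s) * tau by apply: Rmult_le_pos; lra.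
have [|bP bE] := cell_move (e := e) (cover_face_inj inj GT) Ga Gb _ st.
  by rewrite pa pb; apply: ptP => i; rewrite /comb pz /comb; ring.
split=> [|E']; first lra.
rewrite bE; last lra.
by rewrite aE; [apply: ptP => i; rewrite /comb; ring|lra].
Qed.

(** Coordinate [e] is collapsed to [Some false], the value that [tiling] prescribes outside the
    index set. *)
Definition delT e T : {set cface n} :=
  [set F : cface n | (F e == Some false) && [exists o, upd F e o \in T]].
Definition conT e T : {set cface n} :=
  [set F : cface n | (F e == Some false) && (upd F e None \in T)].

Lemma subface_updS F G e o : subface G F -> subface (upd G e o) (upd F e o).
Proof.
move=> /forallP H; apply/forallP => i; rewrite !ffunE; case: eqP => _; last exact: H.
by case: o.
Qed.

Lemma subface_fixed F G e b : subface G F -> F e = Some b -> G e = Some b.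
Proof. by move=> /forallP/(_ e); case: (F e) => // c /eqP -> [->]. Qed.

Lemma setcK (x : pt n) e t : x e = 0 -> setc (setc x e t) e 0 = x.
Proof. by move=> xe; apply: ptP => i; rewrite /setc; case: eqP => // ->. Qed.

Lemma cover_delT T e x : cover (delT e T) x <->
  exists2 x', cover T x' & x = setc x' e 0.
Proof.
split=> [[F]|[x' [F FT Fx] ->]].
  rewrite inE => /andP[/eqP Fe /existsP[o oT]] Fx.
  have xe : x e = 0 by move: (Fx e); rewrite Fe.
  exists (setc x e (if o is Some b then bpt b else 0)); last by rewrite setcK.
  by exists (upd F e o) => //; apply: face_pts_upd => //; case: (o) => //; lra.
exists (upd F e (Some false)); last exact: face_pts_upd.
rewrite inE ffunE eqxx /=; apply/existsP; exists (F e).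
suff -> : upd (upd F e (Some false)) e (F e) = F by [].
by apply/ffunP => i; rewrite !ffunE; case: eqP => // ->.
Qed.

Lemma tiling_del V E T e : e \in E -> tiling V E T -> tiling V (E :\ e) (delT e T).
Proof.
move=> eE tT; have [cl supp inj surj] := tT; split.
- move=> F G; rewrite !inE => /andP[/eqP Fe /existsP[o oT]] GF.
  rewrite (subface_fixed GF Fe) eqxx; apply/existsP; exists o.
  by apply: cl oT _; exact: subface_updS.
- move=> F i; rewrite !inE negb_and negbK => /andP[/eqP Fe /existsP[o oT]].
  case: (altP (i =P e)) => [->//|ie /= iE].
  by have := supp _ _ oT iE; rewrite ffunE (negbTE ie).
- move=> x z /cover_delT [x' Tx ->] /cover_delT [z' Tz ->].
  rewrite !pmap_setc => pxz.
  wlog le : x' z' Tx Tz pxz / x' e <= z' e.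
    move=> H; have [le|lt] := Rle_lt_dec (x' e) (z' e); first exact: H.
    by apply/esym/H => //; lra.
  have [||_ E'] := tiling_slope (e := e) (tau := z' e - x' e) tT Tx Tz.
  + by apply: ptP => i; have := eq_at pxz i; rewrite /comb; lra.
  + lra.
  rewrite E' //; apply: ptP => i; rewrite /setc /comb /bas; case: eqP => // _; ring.
- move=> x cx.
  have cx' : incube E x by apply: incube_sub cx; exact: subsetDl.
  have xe : x e = 0 by apply: cx.2; rewrite !inE eqxx.
  have cx1 : incube E (setc x e 1).
    by apply: incube_setE => //; lra.
  have [a Ta pa] := surj _ cx'; have [b Tb pb] := surj _ cx1.
  (* An intermediate value problem: find [s] in [0,1] such that the point of the tiling over
     [pmap V x + s V e] has coordinate [e] equal to [s]. If there is none, that coordinate stays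
     above [s] and exceeds 1 at the end. *)
  suff [z Tz pz] : exists2 z, cover T z & pmap V z = comb 1 (pmap V x) (z e) (V e).
    exists (setc z e 0); first by apply/cover_delT; exists z.
    by rewrite pmap_setc pz; apply: ptP => i; rewrite /comb; ring.
  apply: NNPP => noz.
  have pbE : pmap V b = comb 1 (pmap V x) 1 (V e) by rewrite pb pmap_setc xe Rminus_0_r.
  have pE s u : pmap V u = comb 1 (pmap V a) s (comb 1 (pmap V b) (-1) (pmap V a)) ->
      pmap V u = comb 1 (pmap V x) s (V e).
    by move=> ->; apply: ptP => i; rewrite /comb pbE pa /comb; ring.
  suff : b e > 1 by have := (cover_incube tT Tb).1 e; lra.
  apply: (path_invariant (P := fun s (u : pt n) => u e > s) inj Ta erefl Tb
    (w := comb 1 (pmap V b) (-1) (pmap V a))).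
  + by apply: ptP => i; rewrite /comb; ring.
  + by move=> s hs; exact: tiling_path tT Ta Tb hs.
  + have := (cover_incube tT Ta).1 e => ae.
    have [//|a0] : a e > 0 \/ a e = 0 by lra.
    by case: noz; exists a => //; rewrite pa a0; apply: ptP => i; rewrite /comb; ring.
  move=> s s' G u v s0 ss' s1 GT Gu Gv /pE pu /pE pv us.
  have [//|vs] := Rlt_le_dec s' (v e).
  have [|l l01 lE] := @zero_crossing (u e - s) (v e - s'); first by left; lra.
  case: noz; exists (comb (1 - l) u l v).
    by exists G => //; apply: face_pts_comb => //; lra.
  rewrite pmap_comb pu pv; apply: ptP => i; rewrite /comb.
  have -> : (1 - l) * u e + l * v e = (1 - l) * s + l * s' by lra.
  ring.
Qed.

Lemma cover_conT T e x : cover (conT e T) x ->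
  x e = 0 /\ forall t, 0 <= t <= 1 -> cover T (setc x e t).
Proof.
move=> [F]; rewrite inE => /andP[/eqP Fe FT] Fx; split.
  by move: (Fx e); rewrite Fe.
by move=> t ht; exists (upd F e None) => //; exact: face_pts_upd.
Qed.

(* Pushing a point as far as possible along the line through it in direction
   [V e] makes its coordinate [e] extremal (up to an error). *)
Lemma tiling_extreme V E T e k x b : tiling V E T -> e \in E -> V e k <> 0 ->
  incube E x -> exists2 a, cover T a &
  (exists t, pmap V a = comb 1 (pmap V x) t (V e)) /\ Rabs (bpt b - a e) <= 1 / 3.
Proof.
move=> tT eE Vek cx; have [_ _ _ surj] := tT.
pose sg := if b then 1 else -1.
pose L r := exists2 u, incube E u & pmap V u = comb 1 (pmap V x) (sg * r) (V e).
pose M := \big[Rplus/0]_(i < n) Rabs (V i k).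
have pM u : incube E u -> Rabs (pmap V u k) <= M.
  move=> [hu _]; apply: Rle_trans (rsum_abs _) _.
  apply: (big_ind2 Rle) => [|*|i _]; [lra|lra|].
  rewrite Rabs_mult -[X in _ <= X]Rmult_1_l.
  apply: Rmult_le_compat_r; first exact: Rabs_pos.
  by have := hu i; split_Rabs; lra.
have Vpos := Rabs_pos_lt _ Vek.
have [|| m [ub lub]] := completeness L.
- exists (2 * M / Rabs (V e k)) => r [u cu pu].
  apply: (Rmult_le_reg_r (Rabs (V e k))) => //.
  have -> : 2 * M / Rabs (V e k) * Rabs (V e k) = 2 * M by field; lra.
  have := pM u cu; have := pM x cx; rewrite pu /comb.
  have : r * Rabs (V e k) <= Rabs (sg * r * V e k).
    rewrite !Rabs_mult; apply: Rmult_le_compat_r; first exact: Rabs_pos.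
    by rewrite /sg; case: (b); split_Rabs; lra.
  by split_Rabs; lra.
- by exists 0, x => //; apply: ptP => i; rewrite /comb; ring.
have [r [[u cu pu] rm]] : exists r, L r /\ m - 1 / 3 < r.
  apply: NNPP => H; have : m <= m - 1 / 3; last lra.
  by apply: lub => r Lr; apply: Rnot_lt_le => ?; apply: H; exists r.
have [a Ta pa] := surj _ cu; exists a => //; split.
  by exists (sg * r); rewrite pa.
have [ha sa] := cover_incube tT Ta.
(* Setting coordinate [e] of [a] to its extreme value pushes the image further by exactly this
   amount, which therefore cannot pass the supremum. *)
suff : r + Rabs (bpt b - a e) <= m by lra.
apply: ub; exists (setc a e (bpt b)).
  by apply: incube_setE => //; rewrite /bpt; case: (b); lra.
rewrite pmap_setc pa pu; apply: ptP => i; rewrite /comb.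
have -> : bpt b - a e = sg * Rabs (bpt b - a e).
  by have := ha e; rewrite /sg /bpt; case: (b); split_Rabs; lra.
rewrite Rabs_mult Rabs_Rabsolu.
have -> : Rabs sg = 1 by rewrite /sg; case: (b); split_Rabs; lra.
ring.
Qed.

(** Injectivity: heights below 1 contradict injectivity of [T] unless zero, and from height 1 on,
    coordinate [e] would have to fall from 1 to 0. Surjectivity: along the line in direction [V e]
    coordinate [e] passes from at most 1/3 to at least 2/3, so some tile met has [e] free; otherwise
    it would stay constant in every tile. *)
Lemma tiling_con V E T e k : e \in E -> V e k <> 0 -> tiling V E T ->
  tiling (contract V e k) (E :\ e) (conT e T).
Proof.
move=> eE Vek tT; have [cl supp inj surj] := tT; split.
- move=> F G; rewrite !inE => /andP[/eqP Fe oT] GF.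
  rewrite (subface_fixed GF Fe) eqxx.
  by apply: cl oT _; exact: subface_updS.
- move=> F i; rewrite !inE negb_and negbK => /andP[/eqP Fe oT].
  case: (altP (i =P e)) => [->//|ie /= iE].
  by have := supp _ _ oT iE; rewrite ffunE (negbTE ie).
- move=> x z Cx Cz /(pmap_contract_eq _ _ Vek) [t pz].
  wlog t0 : x z t Cx Cz pz / 0 <= t.
    move=> H; have [le|lt] := Rle_lt_dec 0 t; first exact: H pz le.
    apply/esym; apply: (H z x (- t)) => //; last lra.
    by rewrite pz; apply: ptP => i; rewrite /comb; ring.
  have [xe Tx] := cover_conT Cx; have [ze Tz] := cover_conT Cz.
  have zE : z = setc z e 0 by apply: ptP => i; rewrite /setc; case: eqP => // ->.
  have Tz0 : cover T z by rewrite zE; apply: Tz; lra.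
  have [t1|t1] := Rlt_le_dec t 1.
    have E' : setc x e t = z.
      by apply: inj => //; [apply: Tx; lra|rewrite pmap_setc pz xe Rminus_0_r].
    have tz : t = 0 by have := eq_at E' e; rewrite /setc eqxx ze.
    by rewrite -E' tz; apply: ptP => i; rewrite /setc; case: eqP => // ->.
  have Tx1 : cover T (setc x e 1) by apply: Tx; lra.
  have [||] := tiling_slope (e := e) (tau := t - 1) tT Tx1 Tz0; last first.
  + by rewrite ze /setc eqxx; lra.
  + lra.
  + by rewrite pmap_setc pz xe; apply: ptP => i; rewrite /comb; ring.
- move=> x cx.
  have cx' : incube E x by apply: incube_sub cx; exact: subsetDl.
  have [a Ta [[ta pa] ae]] := tiling_extreme false tT eE Vek cx'.
  have [b Tb [[tb pb] be]] := tiling_extreme true tT eE Vek cx'.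
  apply: NNPP => noz.
  have noG G u s : G \in T -> face_pts G u -> pmap V u = comb 1 (pmap V x) s (V e) ->
      exists c, G e = Some c.
    move=> GT Gu pu; case Ge: (G e) => [c|]; first by exists c.
    case: noz; exists (setc u e 0).
      exists (upd G e (Some false)); last exact: face_pts_upd.
      rewrite inE ffunE eqxx /=.
      suff -> : upd (upd G e (Some false)) e None = G by [].
      by apply/ffunP => i; rewrite !ffunE; case: eqP => // ->.
    apply/esym/pmap_contract_eq => //; exists (s + (0 - u e)).
    by rewrite pmap_setc pu; apply: ptP => i; rewrite /comb; ring.
  suff : b e <= 1 / 3.
    by move: be; rewrite /bpt; split_Rabs; lra.
  apply: (path_invariant (P := fun _ (u : pt n) => u e <= 1 / 3) inj Ta erefl Tb
    (w := comb 1 (pmap V b) (-1) (pmap V a))).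
  + by apply: ptP => i; rewrite /comb; ring.
  + by move=> s hs; exact: tiling_path tT Ta Tb hs.
  + by move: ae; rewrite /bpt; split_Rabs; lra.
  move=> s s' G u v _ _ _ GT Gu Gv pu _.
  have [|c Gc] := noG G u (ta + s * (tb - ta)) GT Gu.
    by rewrite pu pa pb; apply: ptP => i; rewrite /comb; ring.
  by have := Gu e; have := Gv e; rewrite Gc; case: c {Gc} => -> ->.
Qed.

Lemma upd_vertex b e I : e \notin I -> upd (vertex I) e (Some b) = vertex (addb b e I).
Proof.
move=> eI; apply/ffunP => i; rewrite !ffunE in_addb.
by case: eqP => [->|_] //=; rewrite (negbTE eI) orbF.
Qed.

Lemma subface_updN F e o : subface (upd F e o) (upd F e None).
Proof.
by apply/forallP => i; rewrite !ffunE; case: eqP => // _; case: (F i) => // b; exact: eqxx.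
Qed.

Lemma vertex_notin e I : (vertex I e == Some false) = (e \notin I).
Proof. by rewrite ffunE; case: (e \in I). Qed.

Lemma Vert_con V E T e : tiling V E T -> Vert (conT e T) \subset con e (Vert T).
Proof.
move=> [cl _ _ _]; apply/subsetP => I; rewrite in_set in_set vertex_notin => /andP[eI vT].
apply/mem_con; split=> // b; rewrite in_set -upd_vertex //.
by apply: cl vT _; exact: subface_updN.
Qed.

Lemma Vert_del V E T e : tiling V E T -> Vert (delT e T) = del e (Vert T).
Proof.
move=> [cl _ _ _]; apply/setP => I; rewrite in_set in_set vertex_notin.
apply/andP/idP => [[eI /existsP[o oT]]|/mem_del [eI [b]]].
  apply/mem_del; split=> //; case: o oT => [b|] oT.
    by exists b; rewrite in_set -upd_vertex.
  exists true; rewrite in_set -upd_vertex //.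
  by apply: cl oT _; exact: subface_updN.
by rewrite in_set -upd_vertex // => bT; split=> //; apply/existsP; exists (Some b).
Qed.

Lemma tiling_card V E T : tiling V E T -> (#|IndE V E| <= #|Vert T|)%N.
Proof.
elim/set_ind_D1: E V T => [|E e eE IH] V T tT.
  rewrite IndE0 cards1 card_gt0; apply/set0Pn.
  have [cl _ _ surj] := tT.
  have [|z [F FT _] _] := surj (@zpt n); first by split=> // i; rewrite /zpt; lra.
  exists [set i | F i == Some true]; rewrite in_set; apply: cl FT _.
  by apply/forallP => i; rewrite ffunE inE; case: (F i) => // -[].
rewrite [in X in (_ <= X)%N](card_del_con e) -(Vert_del e tT).
have IHd := IH _ _ (tiling_del eE tT).
have [Ve|[k Vek]] := zpt_or_coord (V e).
  by rewrite (card_IndE_loop E Ve); apply: leq_trans IHd (leq_addr _ _).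
rewrite (card_IndE_contract eE Vek); apply: leq_add => //.
apply: leq_trans (subset_leq_card (Vert_con e tT)).
exact/IH/tiling_con.
Qed.

End Tilings.

(** * Vertices of a tiling are separated *)

Section TilingSeparation.
Variables n d : nat.
Implicit Types (V : config n d) (E I J K : {set 'I_n}) (F G : cface n) (T : {set cface n}).

Definition eps I (i : 'I_n) : R := if i \in I then 1 else -1.

Lemma eps_sqr I i : eps I i * eps I i = 1.
Proof. by rewrite /eps; case: ifP; lra. Qed.

(* [upward I E x]: on [E], the point [x] can be moved in the directions [eps I]
   while staying in the cube. *)
Definition upward I E (x : pt n) :=
  forall i, i \in E -> if i \in I then x i < 1 else x i > 0.
Definition downward I E (x : pt n) :=
  forall i, i \in E -> if i \in I then x i > 0 else x i < 1.

(** The kernel of a circuit is a line. Subtracting from [k] the multiple of [c] with the smallest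
    ratio leaves a relation that vanishes at one [e] and weakly has the signs [eps I]; the
    functional given for [E - e] then kills it. *)
Lemma circuit_kernel V E I c k e0 : e0 \in E ->
  (forall i, i \in E -> eps I i * c i > 0) -> (forall i, i \notin E -> c i = 0) ->
  (forall e, e \in E -> exists2 h, is_linear_fun h &
    forall i, i \in E :\ e -> eps I i * h (V i) > 0) ->
  pmap V c = @zpt d -> pmap V k = @zpt d -> (forall i, i \notin E -> k i = 0) ->
  exists l, forall i, k i = l * c i.
Proof.
move=> e0E cE c0 hE pc pk k0.
have [e eE emin] := finite_argmin (fun i => k i / c i) e0E.
have cn0 j : j \in E -> c j <> 0 by move=> /cE H cj; rewrite cj in H; lra.
exists (k e / c e); set l := k e / c e in emin *.
have [h hl hp] := hE e eE.
pose k' := comb 1 k (- l) c.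
have k'e : k' e = 0 by rewrite /k' /comb /l; field; exact: cn0.
have k'0 j : j \notin E -> k' j = 0 by move=> jE; rewrite /k' /comb k0 // c0 //; ring.
have ek' j : j \in E -> 0 <= eps I j * k' j.
  move=> jE; have -> : eps I j * k' j = (k j / c j - l) * (eps I j * c j).
    by rewrite /k' /comb; field; exact: cn0.
  by apply: Rmult_le_pos; [have := emin j jE; lra|have := cE j jE; lra].
have t0 j : 0 <= k' j * h (V j).
  have [je|je] := eqVneq j e; first by rewrite je k'e; lra.
  have [jE|/k'0 ->] := boolP (j \in E); last lra.
  have -> : k' j * h (V j) = (eps I j * k' j) * (eps I j * h (V j)).
    by rewrite -[LHS]Rmult_1_l -(eps_sqr I j); ring.
  have /hp hj : j \in E :\ e by rewrite !inE je.
  by apply: Rmult_le_pos; [exact: ek'|lra].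
have s0 : \big[Rplus/0]_(j < n) (k' j * h (V j)) = 0.
  rewrite -lin_pmap // pmap_comb pc pk -(lin_zpt hl); congr h.
  by apply: ptP => j; rewrite /comb /zpt; ring.
move=> i; suff : k' i = 0 by rewrite /k' /comb; lra.
have [->//|ie] := eqVneq i e.
have [iE|/k'0 //] := boolP (i \in E).
have /hp hi : i \in E :\ e by rewrite !inE ie.
have /Rmult_integral := rsum_eq0 t0 s0 i.
by case=> // hi0; rewrite hi0 in hi; lra.
Qed.

(* When [I] and [J] are complementary in [E] and every proper deletion is
   separated, a failure of separation is a circuit [c] with sign vector [eps I].
   Then a point of the tiling is never both upward and downward, while the
   points over the segment from [J] to [I] are all upward or downward, so
   upwardness cannot change along the segment. *)
Lemma tiling_sep_complement V E I J T : tiling V E T ->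
  (forall i, i \in E -> (i \in J) = (i \notin I)) ->
  vertex I \in T -> vertex J \in T ->
  (forall e, e \in E -> exists2 h, is_linear_fun h &
    forall i, i \in E :\ e -> eps I i * h (V i) > 0) ->
  exists2 h, is_linear_fun h & forall i, i \in E -> eps I i * h (V i) > 0.
Proof.
move=> tT IJ IT JT hE; have [_ supp inj _] := tT.
have [[h [hl hp]]|[a [a0 aE [e0 e0E ae0] pa]]] :=
    gordan (fun i => comb (eps I i) (V i) 0 (V i)) E.
  exists h => // i iE; have := hp i iE; rewrite lin_comb //; lra.
pose c i := eps I i * a i.
have c0 i : i \notin E -> c i = 0 by move=> /aE ai; rewrite /c ai; ring.
have pc : pmap V c = @zpt d.
  by rewrite -pa; apply: ptP => k; apply: eq_bigr => i _; rewrite /c /comb; ring.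
have epc i : eps I i * c i = a i by rewrite /c -Rmult_assoc eps_sqr Rmult_1_l.
(* A relation missing [e] would have only nonnegative terms, one of them positive, under the
   functional given for [E - e]. *)
have apos e : e \in E -> a e > 0.
  move=> eE; have [//|ae] : a e > 0 \/ a e = 0 by have := a0 e; lra.
  have [h hl hp] := hE e eE; exfalso.
  have := lin_pmap V c hl; rewrite pc lin_zpt // => /esym s0.
  have ie0 : e0 \in E :\ e.
    by rewrite !inE e0E andbT; apply/eqP => e0e; move: ae0; rewrite e0e ae; lra.
  have : c e0 * h (V e0) = 0.
    apply: (rsum_eq0 _ s0) => i; have [iE|iE] := boolP (i \in E); last by rewrite c0 //; lra.
    have [ie|ie] := eqVneq i e; first by rewrite /c ie ae; lra.
    have /hp hi : i \in E :\ e by rewrite !inE ie.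
    have -> : c i * h (V i) = a i * (eps I i * h (V i)) by rewrite /c; ring.
    by apply: Rmult_le_pos => //; lra.
  have -> : c e0 * h (V e0) = a e0 * (eps I e0 * h (V e0)) by rewrite /c; ring.
  by have := hp e0 ie0; nra.
(* All coordinates in [E] would be strictly inside [0,1], hence free in the tile, and [c] would be a
   kernel direction of an injective face. *)
have noUD x : cover T x -> upward I E x -> downward I E x -> False.
  move=> [G GT Gx] U D.
  have := face_free_inj (cover_face_inj inj GT) (c := c) _ pc => H.
  have /eq_at/(_ e0) : c = @zpt n.
    apply: H => i Gi; apply: c0; apply/negP => iE.
    by move: (U i iE) (D i iE) (Gx i); case: (i \in I); case: (G i) Gi => [[]|] //= _; lra.
  by have := epc e0; rewrite /zpt => Ee ce0; rewrite ce0 in Ee; lra.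
have cov K : vertex K \in T -> cover T (vpt K).
  by move=> KT; exists (vertex K) => //; apply/face_pts_vpt; exact: subface_refl.
have [TI TJ] := (cov I IT, cov J JT).
have [[cI sI] [cJ sJ]] := (cover_incube tT TI, cover_incube tT TJ).
pose q s := comb (1 - s) (vpt J) s (vpt I).
have qE s i : i \in E -> q s i = if i \in I then s else 1 - s.
  by move=> iE; rewrite /q /comb /vpt (IJ i iE); case: (i \in I) => /=; ring.
have UD s u : 0 < s < 1 -> cover T u -> pmap V u = pmap V (q s) ->
    upward I E u \/ downward I E u.
  move=> hs Tu pu; have [_ su] := cover_incube tT Tu.
  have [|||l lE] := @circuit_kernel V E I c (comb 1 u (-1) (q s)) e0 e0E _ c0 hE pc.
  - by move=> i /apos; rewrite epc.
  - by rewrite pmap_comb pu; apply: ptP => k; rewrite /comb /zpt; ring.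
  - by move=> i iE; rewrite /q /comb su // sI // sJ //; ring.
  have uE i : i \in E -> u i = (if i \in I then s else 1 - s) + l * c i.
    by move=> iE; rewrite -(qE _ _ iE); have := lE i; rewrite {1}/comb; lra.
  (* Here [u] is [q s + l c], with [q s] interior on [E], so moving with or against [c] decides
     between downward and upward. *)
  have [l0|l0] := Rle_lt_dec l 0; [left|right]; move=> i iE;
    by have := apos i iE; rewrite uE // /c /eps; case: (i \in I) => ai; nra.
exfalso; suff : upward I E (vpt I).
  by move/(_ e0 e0E); rewrite /vpt; case: (e0 \in I); lra.
pose w := comb 1 (pmap V (vpt I)) (-1) (pmap V (vpt J)).
have pq s u : pmap V u = comb 1 (pmap V (vpt J)) s w -> pmap V u = pmap V (q s).
  by move=> ->; rewrite pmap_comb; apply: ptP => i; rewrite /w /comb; ring.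
apply: (path_invariant (P := fun _ => upward I E) inj TJ erefl TI (w := w)).
- by apply: ptP => i; rewrite /w /comb; ring.
- by move=> s hs; exact: tiling_path tT TJ TI hs.
- by move=> i iE; rewrite /vpt (IJ i iE); case: (i \in I) => /=; lra.
move=> s s' G u v s0 ss' s1 GT Gu Gv pu /pq pv Uu.
have Tv : cover T v by exists G.
have [//|Dv] : upward I E v \/ downward I E v.
  have [s'0|[s'1|s'01]] : s' = 0 \/ (s' = 1 \/ 0 < s' < 1) by [lra]; last exact: UD pv.
    left; suff -> : v = vpt J.
      by move=> i iE; rewrite /vpt (IJ i iE); case: (i \in I) => /=; lra.
    apply: inj => //; rewrite pv s'0; congr (pmap V _).
    by apply: ptP => i; rewrite /q /comb; ring.
  right; suff -> : v = vpt I.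
    by move=> i iE; rewrite /vpt; case: (i \in I) => /=; lra.
  apply: inj => //; rewrite pv s'1; congr (pmap V _).
  by apply: ptP => i; rewrite /q /comb; ring.
(* The midpoint of an upward and a downward point of the same tile is both. *)
exfalso; apply: (noUD (comb (1 - 1 / 2) u (1 / 2) v)).
- by exists G => //; apply: face_pts_comb => //; lra.
- move=> i iE; have := Uu i iE.
  by have := face_pts_cube Gv i; rewrite /comb; case: (i \in I); lra.
- move=> i iE; have := Dv i iE.
  by have := face_pts_cube Gu i; rewrite /comb; case: (i \in I); lra.
Qed.

(** If [I] and [J] agree at some [e] in [E], that element is deleted; otherwise they are
    complementary in [E]. The complementary case needs the deletion of every element at once, hence
    the strong induction. *)
Lemma tiling_sep V E T : tiling V E T -> Vseparated_coll V (Vert T).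
Proof.
elim/set_ind_strong: E T => E IH T tT I J; rewrite !in_set => IT JT.
have [cl supp _ _] := tT.
have vdel K e : vertex K \in T -> K :\ e \in Vert (delT e T).
  move=> KT; rewrite (Vert_del e tT); apply/mem_del; split; first by rewrite !inE eqxx.
  exists (e \in K); rewrite in_set; suff -> : addb (e \in K) e (K :\ e) = K by [].
  apply/setP => i; rewrite in_addb !inE.
  by case: (altP (i =P e)) => [->|]; rewrite ?orbF.
have sub K i : vertex K \in T -> i \notin E -> i \notin K.
  by move=> KT iE; have := supp _ _ KT iE; rewrite ffunE => -[->].
have [[e [eE eIJ]]|nex] := classic (exists e, e \in E /\ (e \in I) = (e \in J)).
  have [h [hl [hp hn]]] := IH e eE _ (tiling_del eE tT) _ _ (vdel _ e IT) (vdel _ e JT).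
  exists h; split=> //; split=> i; rewrite !inE => /andP[i1 i2];
    [apply: hp|apply: hn]; rewrite !inE i2 (negbTE i1) ?andbF ?andbT /=.
  - by apply: contraNneq i1 => ie; rewrite ie -eIJ -ie.
  - by apply: contraNneq i1 => ie; rewrite ie eIJ -ie.
have IJ i : i \in E -> (i \in J) = (i \notin I).
  move=> iE; have : (i \in I) <> (i \in J) by move=> H; apply: nex; exists i.
  by case: (i \in I); case: (i \in J).
have [e eE|h hl hp] := tiling_sep_complement tT IJ IT JT.
  have [h [hl [hp hn]]] := IH e eE _ (tiling_del eE tT) _ _ (vdel _ e IT) (vdel _ e JT).
  exists h => // i; rewrite !inE => /andP[ie iE]; rewrite /eps.
  case iI: (i \in I).
    have /hp : i \in I :\ e :\: (J :\ e) by rewrite !inE IJ // ie iI.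
    by lra.
  have /hn : i \in J :\ e :\: (I :\ e) by rewrite !inE IJ // ie iI.
  by lra.
exists h; split=> //; split=> i; rewrite inE => /andP[i1 i2].
  have iE : i \in E by apply: contraTT i2 => /(sub _ _ IT).
  by have := hp i iE; rewrite /eps i2; lra.
have iE : i \in E by apply: contraTT i2 => /(sub _ _ JT).
by have := hp i iE; rewrite /eps (negbTE i1); lra.
Qed.

End TilingSeparation.

(** * Assembling the bijection and the count *)

Section Main.
Variables n d : nat.
Implicit Types (V : config n d) (S : {set {set 'I_n}}) (T : {set cface n}).

Lemma IndE_setT V : IndE V setT = Ind V.
Proof. by apply/setP => I; rewrite in_setI powersetE subsetT andbT. Qed.

Lemma sub_powersetT S : S \subset powerset setT.
Proof. by apply/subsetP => I _; rewrite powersetE subsetT. Qed.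

Lemma sep_card_le_Ind V S : Vseparated_coll V S -> (#|S| <= #|Ind V|)%N.
Proof. by rewrite -IndE_setT; apply: sep_card_le; exact: sub_powersetT. Qed.

Lemma max_by_size_card V S : max_by_size V S -> #|S| = #|Ind V|.
Proof.
move=> [sS maxS]; apply/eqP; rewrite eqn_leq sep_card_le_Ind //=.
have [r gr] := exists_generic V setT.
rewrite -IndE_setT; apply: leq_trans (card_regions gr) _.
by apply: maxS; exact: regions_sep.
Qed.

(** [Rmax L 0 + 1] replaces [L], which may be zero or negative. *)
Lemma lipschitz_continuous k l (x x' : pt k) (y y' : pt l) L eps : eps > 0 ->
  (forall i, Rabs (x i - x' i) <= L * dist y y') ->
  dist y y' < eps / (Rmax L 0 + 1) -> dist x x' < eps.
Proof.
move=> e0 H yy'; apply: dist_lt => // i; apply: Rle_lt_trans (H i) _.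
have L0 := Rmax_r L 0; have LL := Rmax_l L 0; have D0 := dist_ge0 y y'.
apply: (Rle_lt_trans _ ((Rmax L 0 + 1) * dist y y')).
  by apply: Rmult_le_compat_r => //; lra.
have -> : eps = (Rmax L 0 + 1) * (eps / (Rmax L 0 + 1)) by field; lra.
by apply: Rmult_lt_compat_l => //; lra.
Qed.

Lemma full_faces_tiling V S : Vseparated_coll V S -> #|S| = #|Ind V| ->
  fine_tiling V (full_faces S).
Proof.
move=> sS cS; split; first by move=> F G; exact: full_faces_sub.
have delta_pos L eps : eps > 0 -> eps / (Rmax L 0 + 1) > 0.
  by move=> e0; apply: Rdiv_lt_0_compat => //; have := Rmax_r L 0; lra.
have inj := full_faces_inj sS.
split; [|split; [|split; [|split]]].
- by move=> x [F _ Fx]; exists x; split=> //; exact: face_pts_cube Fx.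
- move=> _ [x [hx <-]].
  have [||z Cz pz] := full_faces_surj (sub_powersetT S) sS _ (x := x).
  + by rewrite IndE_setT.
  + by split=> // i; rewrite inE.
  by exists z.
- exact: inj.
- move=> x0 Cx0 eps e0; have [L HL] := pmap_lipschitz V.
  exists (eps / (Rmax L 0 + 1)); split; first exact: delta_pos.
  by move=> x Cx; apply: lipschitz_continuous => // i; exact: HL.
- move=> x0 Cx0 eps e0; have [L HL] := full_faces_lipschitz sS.
  exists (eps / (Rmax L 0 + 1)); split; first exact: delta_pos.
  by move=> x Cx; apply: lipschitz_continuous => // i; exact: HL.
Qed.

Lemma fine_tiling_max V T : fine_tiling V T -> max_by_size V (Vert T).
Proof.
move=> /fine_tilingW tT; split; first exact: tiling_sep tT.
move=> S' /sep_card_le_Ind le; apply: leq_trans le _.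
by rewrite -IndE_setT; exact: tiling_card.
Qed.

Lemma tiling_sub_full V T : fine_tiling V T -> T \subset full_faces (Vert T).
Proof.
move=> [cl _]; apply/subsetP => F FT; apply/full_facesP => I IF.
by rewrite in_set; exact: cl FT IF.
Qed.

Lemma cover_mono T T' (x : pt n) : T \subset T' -> cover T x -> cover T' x.
Proof. by move=> /subsetP TT' [F /TT' FT Fx]; exists F. Qed.

(** Both tilings lie in the full faces of their common vertex set, where the projection is
    injective. Hence the centre of a face [F] of [T1] lies in a face of [T2], which must have [F] as
    a face. *)
Lemma Vert_inj_sub V T1 T2 : fine_tiling V T1 -> fine_tiling V T2 ->
  Vert T1 = Vert T2 -> T1 \subset T2.
Proof.
move=> t1 t2 V12; apply/subsetP => F FT.
have [sS _] := fine_tiling_max t2; have inj := full_faces_inj sS.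
have [cl _ _ surj] := fine_tilingW t2.
have F1 : cover T1 (center F) by exists F => //; exact: face_pts_center.
have [|z Tz pz] := surj (center F).
  by apply: cover_incube (fine_tilingW t1) F1.
have zF : z = center F.
  apply: inj => //; first exact: cover_mono (tiling_sub_full t2) Tz.
  by rewrite -V12; exact: cover_mono (tiling_sub_full t1) F1.
case: Tz => G GT; rewrite zF => /carrier_subface; rewrite carrier_center.
exact: cl GT.
Qed.

End Main.

Theorem theorem2p3 (n d : nat) (V : config n d) :
  (forall T : {set cface n}, fine_tiling V T -> max_by_size V (Vert T)) /\
  (forall T1 T2 : {set cface n}, fine_tiling V T1 -> fine_tiling V T2 ->
     Vert T1 = Vert T2 -> T1 = T2) /\
  (forall S : {set {set 'I_n}}, max_by_size V S ->
     exists T : {set cface n}, fine_tiling V T /\ Vert T = S) /\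
  (forall S : {set {set 'I_n}}, max_by_size V S -> #|S| = #|Ind V|).
Proof.
split; first exact: fine_tiling_max.
split.
  move=> T1 T2 t1 t2 V12; apply/eqP; rewrite eqEsubset.
  by rewrite (Vert_inj_sub t1 t2 V12) (Vert_inj_sub t2 t1).
split; last exact: max_by_size_card.
move=> S mS; exists (full_faces S); split; last exact: Vert_full.
by apply: full_faces_tiling (max_by_size_card mS); exact: mS.1.
Qed.
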